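(* Let $\ell^*\in[2\pi,\infty)$ be a point at which the energy profile curve $E:[2\pi,\infty)\to[0,\infty)$, $$E(\ell)=\inf\bigl\{\mathcal E(\gamma)\mid \gamma\in W^{2,2}_{\mathrm{Imm}}(\mathbb S^1,\mathbb R^2),\ n_\gamma=1,\ \mathcal A(\gamma)=\pi,\ \mathcal L(\gamma)=\ell\bigr\},$$ attains its global maximum. Then $E(\ell^* )>2\pi$; in particular the maximum is not achieved by the circle (i.e. $\ell^*\neq2\pi$).
   Context: $\mathbb S^1=\mathbb R/2\pi\mathbb Z$. $W^{2,2}_{\mathrm{Imm}}(\mathbb S^1,\mathbb R^2)$ is the set of $\gamma\in W^{2,2}(\mathbb S^1,\mathbb R^2)$ with $\partial_x\gamma(x)\ne0$ for all $x$. For such $\gamma$ write $ds=|\partial_x\gamma|\,dx$, $\partial_s=\partial_x/|\partial_x\gamma|$, $\tau=\partial_s\gamma=(\tau_1,\tau_2)$, $\nu=(-\tau_2,\tau_1)$, $\kappa$ defined by $\partial_s\tau=\kappa\nu$; $\mathcal E(\gamma)=\int\kappa^2ds$, $\mathcal L(\gamma)=\int ds$, $\mathcal A(\gamma)=-\frac12\int\nu\cdot\gamma\,ds$ (algebraic area), $n_\gamma=\frac1{2\pi}\int\kappa\,ds$ (winding number). At $\ell=2\pi$ the unit circle is the only admissible curve up to translation and reparametrization, and $E(2\pi)=2\pi$. $E$ is continuous and tends to $0$ at infinity, so a global maximum exists. *)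

(* Defs.v *)
From HB Require Import structures.
From mathcomp Require Import all_boot all_order all_algebra.
From mathcomp Require Import all_classical all_reals all_analysis.

Set Implicit Arguments.
Unset Strict Implicit.
Unset Printing Implicit Defensive.
Import Order.TTheory GRing.Theory Num.Theory.
Import numFieldNormedType.Exports.
Local Open Scope classical_set_scope.
Local Open Scope ring_scope.

(* Functions on R/2piZ are 2pi-periodic functions on R, integrated over the
   period [0, 2pi]. *)

Definition period (R : realType) : set R := `[0, 2 * pi]%classic.
Arguments period : clear implicits.

Definition circle_int (R : realType) (f : R -> R) : R :=
  \int[lebesgue_measure]_(x in period R) f x.

Definition L1_circle (R : realType) (f : R -> R) : Prop :=
  f \_ (period R) \in Lfun lebesgue_measure 1%:E.

Definition L2_circle (R : realType) (f : R -> R) : Prop :=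
  f \_ (period R) \in Lfun lebesgue_measure 2%:E.

Definition test_function (R : realType) (phi : R -> R) : Prop :=
  periodic phi (2 * pi) /\
  forall (n : nat) (x : R), derivable (derive1n n phi) x 1.

Definition weak_derivative (R : realType) (f g : R -> R) : Prop :=
  [/\ L1_circle f, L1_circle g &
      forall phi : R -> R, test_function phi ->
        circle_int (fun x => f x * derive1 phi x)
        = - circle_int (fun x => g x * phi x)].

(* An element of W^{2,2} is represented by its unique continuous
   representative.  By the Sobolev embedding that representative is C^1, so
   that its pointwise derivative [derive1 f] used below is the continuous
   representative of the weak derivative. *)
Definition W22 (R : realType) (f : R -> R) : Prop :=
  [/\ periodic f (2 * pi), continuous f &
      exists f1 f2 : R -> R,
        [/\ L2_circle f, L2_circle f1, L2_circle f2,
            weak_derivative f f1 & weak_derivative f1 f2]].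

(* Plane vectors are pairs; the library norm on [R * R] is the sup norm, hence
   the explicit Euclidean structure. *)
Definition dot (R : realType) (u v : R * R) : R := u.1 * v.1 + u.2 * v.2.

Definition enorm (R : realType) (u : R * R) : R := Num.sqrt (dot u u).

Definition velocity (R : realType) (gam : R -> R * R) (x : R) : R * R :=
  (derive1 (fst \o gam) x, derive1 (snd \o gam) x).

Definition W22_Imm (R : realType) (gam : R -> R * R) : Prop :=
  [/\ W22 (fst \o gam), W22 (snd \o gam) & forall x, velocity gam x != 0].

Definition speed (R : realType) (gam : R -> R * R) (x : R) : R :=
  enorm (velocity gam x).

Definition int_ds (R : realType) (gam : R -> R * R) (f : R -> R) : R :=
  circle_int (fun x => f x * speed gam x).

Definition tangent (R : realType) (gam : R -> R * R) (x : R) : R * R :=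
  ((velocity gam x).1 / speed gam x, (velocity gam x).2 / speed gam x).

Definition normal (R : realType) (gam : R -> R * R) (x : R) : R * R :=
  (- (tangent gam x).2, (tangent gam x).1).

(* [d_s tau = kappa nu] in the weak sense, i.e. the weak derivative of [tau]
   with respect to [x] is [|d_x gamma| kappa nu]. *)
Definition is_curvature (R : realType) (gam : R -> R * R) (k : R -> R) : Prop :=
  [/\ measurable_fun (period R) k,
      weak_derivative (fun x => (tangent gam x).1)
                      (fun x => speed gam x * (k x * (normal gam x).1)) &
      weak_derivative (fun x => (tangent gam x).2)
                      (fun x => speed gam x * (k x * (normal gam x).2))].

(* The curvature is only determined almost everywhere: [curvature gam] picks
   one representative. *)
Definition curvature (R : realType) (gam : R -> R * R) : R -> R :=
  xget (fun=> 0) [set k | is_curvature gam k].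

Definition energy (R : realType) (gam : R -> R * R) : R :=
  int_ds gam (fun x => curvature gam x ^+ 2).

Definition curve_length (R : realType) (gam : R -> R * R) : R :=
  int_ds gam (fun=> 1).

Definition area (R : realType) (gam : R -> R * R) : R :=
  - 2^-1 * int_ds gam (fun x => dot (normal gam x) (gam x)).

Definition winding (R : realType) (gam : R -> R * R) : R :=
  (2 * pi)^-1 * int_ds gam (curvature gam).

Definition admissible (R : realType) (l : R) : set (R -> R * R) :=
  [set gam | [/\ W22_Imm gam, winding gam = 1, area gam = pi
               & curve_length gam = l]].

Definition energy_profile (R : realType) (l : R) : R :=
  inf (@energy R @` admissible l).

(* Main.v *)
Require Import Defs.
From HB Require Import structures.
From mathcomp Require Import all_boot all_order all_algebra.
From mathcomp Require Import all_classical all_reals all_analysis.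
From mathcomp Require Import measurable_realfun ring lra.

(* It suffices to find one length [l] with [E l > 2 pi], and to see that the
   unit circle gives [E (2 pi) <= 2 pi]. Take [l = 2 pi r] with [r] slightly
   larger than [1]; an explicit oval shows that [l] is attained. For the lower
   bound let [q = nu . gam] and [u = tau . gam], so that [q' = - kappa u] and
   [u' = 1 + kappa q] with respect to arclength, [\int q = - 2 pi] and
   [\int kappa q = - l]. Expanding [\int (kappa + q / r ^+ 2) ^+ 2 >= 0], and
   using the Wirtinger inequality [W := r ^+ 2 l - \int |gam| ^+ 2 >= 0] valid
   after a translation, gives
     [l / r ^+ 2 + (W + U) / r ^+ 4 <= \int kappa ^+ 2], [U := \int u ^+ 2].
   Conversely [q] oscillates by at most half of
   [\int |kappa u| <= sqrt (U \int kappa ^+ 2)] around the curve, which bounds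
   the variance of [q] by [U] and hence [r ^+ 2 l - 4 pi ^+ 2 / l] by a multiple
   of [W + U]. Near the circle the constants leave room for a gap as soon as
   [pi < 2 sqrt 3]. *)

Set Implicit Arguments.
Unset Strict Implicit.
Unset Printing Implicit Defensive.
Import Order.TTheory GRing.Theory Num.Theory.
Import numFieldNormedType.Exports.
Local Open Scope classical_set_scope.
Local Open Scope ring_scope.

(** * Integrals over compact intervals *)

(** The threshold [2 sqrt 3] is a first-order count at [r = 1 + e]. With area [pi] and [l = 2 pi r],
    the defect [r ^+ 2 l - 4 pi ^+ 2 / l] is about [8 pi e]. An energy of at most [2 pi] would make
    [E - l / r ^+ 2] at most about [2 pi e], and this gets multiplied by [1 + E l / 16], about
    [1 + pi ^+ 2 / 4]. Hence [4 <= 1 + pi ^+ 2 / 4], which is false for [pi ^+ 2 < 12]. As the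
    profile is an infimum, strictness curve by curve would not suffice: [e] is fixed and a margin
    [e / 20] common to all curves is kept. The obstacle is regularity. Second derivatives exist only
    weakly and the curvature is an arbitrary almost everywhere representative, so the equations for
    [q'] and [u'] have no pointwise meaning. They are read as integral identities, the predicate
    [ac], whose product rule comes from Fubini; the du Bois-Reymond lemma turns weak derivatives
    into this form. Curves keep their parametrization, with the speed as a weight in every
    integral. *)

Definition integ (R : realType) (a b : R) (f : R -> R) : Prop :=
  lebesgue_measure.-integrable `[a, b] (EFin \o f).

Definition itg (R : realType) (a b : R) (f : R -> R) : R :=
  \int[lebesgue_measure]_(x in `[a, b]) f x.

Definition wcont (R : realType) (a b : R) (f : R -> R) : Prop :=
  {within `[a, b], continuous f}.

Section Toolkit.
Context {R : realType}.
Implicit Types (a b c k x y : R) (f g : R -> R).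

Lemma wcontD a b f g : wcont a b f -> wcont a b g -> wcont a b (fun x => f x + g x).
Proof. by move=> cf cg x; apply: cvgD; [exact: cf|exact: cg]. Qed.

Lemma wcontM a b f g : wcont a b f -> wcont a b g -> wcont a b (fun x => f x * g x).
Proof. by move=> cf cg x; apply: cvgM; [exact: cf|exact: cg]. Qed.

Lemma wcontN a b f : wcont a b f -> wcont a b (fun x => - f x).
Proof. by move=> cf x; apply: cvgN; exact: cf. Qed.

Lemma wcontB a b f g : wcont a b f -> wcont a b g -> wcont a b (fun x => f x - g x).
Proof. by move=> cf cg; apply: wcontD => //; exact: wcontN. Qed.

Lemma wcont_cst a b k : wcont a b (fun=> k).
Proof. by move=> x; apply: cvg_cst. Qed.

Lemma wcont_id a b : wcont a b (fun x => x).
Proof. by apply: continuous_subspaceT => x; exact: cvg_id. Qed.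

Lemma wcont_comp a b f g : wcont a b f -> continuous g -> wcont a b (fun x => g (f x)).
Proof. by move=> cf cg x; apply: continuous_comp; [exact: cf|exact: cg]. Qed.

Lemma wcontX a b f n : wcont a b f -> wcont a b (fun x => f x ^+ n).
Proof.
move=> cf; apply: (wcont_comp (g := fun y => y ^+ n) cf) => x; exact: exprn_continuous.
Qed.

Lemma wcontV a b f : wcont a b f -> (forall x, a <= x <= b -> f x != 0) ->
  wcont a b (fun x => (f x)^-1).
Proof.
move=> cf f0; apply/subspace_continuousP => x xab; apply: cvgV.
  by apply: f0; move: xab; rewrite /= in_itv.
by move/subspace_continuousP : cf; apply.
Qed.

Lemma wcontT a b f : continuous f -> wcont a b f.
Proof. by move=> cf; apply: continuous_subspaceT. Qed.

Lemma wcontS a b c d f : a <= c -> d <= b -> wcont a b f -> wcont c d f.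
Proof.
move=> ac db; apply: continuous_subspaceW => x /=; rewrite !in_itv/= => /andP[cx xd].
by rewrite (le_trans ac cx) (le_trans xd db).
Qed.

Lemma eq_wcont a b f g : (forall x, a <= x <= b -> f x = g x) ->
  wcont a b f -> wcont a b g.
Proof.
move=> fg; apply: subspace_eq_continuous => x; rewrite inE/= in_itv/= => xab.
exact: fg.
Qed.

Lemma eq_integ a b f g : (forall x, a <= x <= b -> f x = g x) ->
  integ a b f -> integ a b g.
Proof.
move=> fg; apply: eq_integrable => // x; rewrite inE/= in_itv/= => xab.
by rewrite /= fg.
Qed.

Lemma integD a b f g : integ a b f -> integ a b g -> integ a b (fun x => f x + g x).
Proof. move=> fi gi; exact: (integrableD _ fi gi). Qed.

Lemma integZ a b k f : integ a b f -> integ a b (fun x => k * f x).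
Proof. move=> fi; exact: (integrableZl _ k fi). Qed.

Lemma integN a b f : integ a b f -> integ a b (fun x => - f x).
Proof. by move=> /(integZ (-1)); apply: eq_integ => x _; rewrite mulN1r. Qed.

Lemma integB a b f g : integ a b f -> integ a b g -> integ a b (fun x => f x - g x).
Proof. by move=> fi gi; apply: integD => //; exact: integN. Qed.

Lemma integ_norm a b f : integ a b f -> integ a b (fun x => `|f x|).
Proof. exact: integrable_norm. Qed.

Lemma integ_cont a b f : wcont a b f -> integ a b f.
Proof. by apply: continuous_compact_integrable; exact: segment_compact. Qed.

Lemma wcont_bounded a b f : wcont a b f ->
  exists2 M, 0 <= M & forall x, a <= x <= b -> `|f x| <= M.
Proof.
move=> cf; have := continuous_compact cf (@segment_compact _ a b).
move=> /compact_bounded[M [_ mrt]]; exists (`|M| + 1) => [|x xab].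
  by rewrite addr_ge0.
apply: (mrt (`|M| + 1)); first by rewrite ltr_pwDr// ler_norm.
by exists x => //=; rewrite in_itv.
Qed.

Lemma integ_measurable a b f : integ a b f -> measurable_fun `[a, b] f.
Proof. by move=> /integrableP[/measurable_EFinP]. Qed.

Lemma wcont_measurable a b f : wcont a b f -> measurable_fun `[a, b] f.
Proof. by move/integ_cont/integ_measurable. Qed.

Lemma integ_le a b f g : measurable_fun `[a, b] f -> integ a b g ->
  (forall x, a <= x <= b -> `|f x| <= g x) -> integ a b f.
Proof.
move=> mf gi fg; apply: le_integrable gi => //; first exact/measurable_EFinP.
move=> x /=; rewrite in_itv/= => xab; rewrite lee_fin.
by rewrite (le_trans (fg _ xab))// ler_norm.
Qed.

Lemma integMc a b f g : wcont a b f -> integ a b g -> integ a b (fun x => f x * g x).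
Proof.
move=> cf gi; have [M M0 fM] := wcont_bounded cf.
apply: (integ_le (g := fun x => M * `|g x|)).
- by apply: measurable_funM; [exact: wcont_measurable|exact: integ_measurable].
- by apply: integZ; exact: integ_norm.
- by move=> x xab; rewrite normrM ler_wpM2r ?fM.
Qed.

Lemma integS a b c d f : a <= c -> d <= b -> integ a b f -> integ c d f.
Proof.
move=> ac db; apply: integrableS => //.
move=> x /=; rewrite !in_itv/= => /andP[cx xd].
by rewrite (le_trans ac cx) (le_trans xd db).
Qed.

Lemma itgD a b f g : integ a b f -> integ a b g ->
  itg a b (fun x => f x + g x) = itg a b f + itg a b g.
Proof. by move=> fi gi; rewrite /itg RintegralD. Qed.

Lemma itgB a b f g : integ a b f -> integ a b g ->
  itg a b (fun x => f x - g x) = itg a b f - itg a b g.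
Proof. by move=> fi gi; rewrite /itg RintegralB. Qed.

Lemma itgZ a b k f : integ a b f -> itg a b (fun x => k * f x) = k * itg a b f.
Proof. by move=> fi; rewrite /itg RintegralZl. Qed.

Lemma eq_itg a b f g : (forall x, a <= x <= b -> f x = g x) -> itg a b f = itg a b g.
Proof.
by move=> fg; apply: eq_Rintegral => x; rewrite inE/= in_itv/= => xab; rewrite fg.
Qed.

Lemma itg_cst a b k : a <= b -> itg a b (fun=> k) = k * (b - a).
Proof.
move=> ab; rewrite /itg Rintegral_cst//= lebesgue_measure_itv/= lte_fin.
move: ab; rewrite le_eqVlt => /predU1P[->|->//].
by rewrite ltxx /= subrr.
Qed.

Lemma le_itg a b f g : integ a b f -> integ a b g ->
  (forall x, a <= x <= b -> f x <= g x) -> itg a b f <= itg a b g.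
Proof.
move=> fi gi fg; apply: le_Rintegral => // x; rewrite /= in_itv/=; exact: fg.
Qed.

Lemma itg_ge0 a b f : (forall x, a <= x <= b -> 0 <= f x) -> 0 <= itg a b f.
Proof. by move=> f0; apply: Rintegral_ge0 => x; rewrite /= in_itv/=; exact: f0. Qed.

Lemma normr_itg a b f : integ a b f -> `|itg a b f| <= itg a b (fun x => `|f x|).
Proof. by move=> fi; apply: le_normr_Rintegral. Qed.

Lemma itg_pt a f : itg a a f = 0.
Proof. by rewrite /itg set_itv1 Rintegral_set1. Qed.

Lemma itg_chasles a b c f : a <= c -> c <= b -> integ a b f ->
  itg a b f = itg a c f + itg c b f.
Proof.
move=> ac cb fi; have := @Rintegral_itvB R f (BLeft a) (BRight b) c fi.
rewrite !bnd_simp => /(_ ac cb) /eqP; rewrite subr_eq => /eqP.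
rewrite /itg => ->; rewrite addrC; congr (_ + _).
apply: Rintegral_itv_obnd_cbnd.
apply: integrableS fi => // x /=; rewrite !in_itv/= => /andP[cx ->].
by rewrite (le_trans ac (ltW cx)).
Qed.

End Toolkit.

(** * Absolutely continuous functions *)

Section Fubini_triangle.
Context {R : realType}.
Implicit Types (a b s t x y : R) (f g : R -> R).
Notation mu := (@lebesgue_measure R).

Lemma itg_patch a b f : itg a b f = \int[mu]_x (f \_ `[a, b]) x.
Proof. by rewrite /itg Rintegral_mkcond. Qed.

Lemma integ_patch a b f : integ a b f -> mu.-integrable setT (EFin \o (f \_ `[a, b])).
Proof. by move=> fi; rewrite -restrict_EFin; apply/integrable_restrict => //; rewrite setTI. Qed.

Lemma fine_itg a b f : integ a b f -> (\int[mu]_(x in `[a, b]) (f x)%:E)%E = (itg a b f)%:E.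
Proof. by move=> fi; rewrite /itg /Rintegral fineK//; exact: integrable_fin_num. Qed.

(* Fubini on the triangle [a <= t <= s <= b]. *)
Lemma itg_triangle a b f g : integ a b f -> integ a b g ->
  itg a b (fun s => f s * itg a s g) = itg a b (fun t => itg t b f * g t).
Proof.
move=> fi gi.
set F := f \_ `[a, b]; set G := g \_ `[a, b].
have Fi : mu.-integrable setT (EFin \o F) by exact: integ_patch.
have Gi : mu.-integrable setT (EFin \o G) by exact: integ_patch.
have mF : measurable_fun setT F by move/integrableP : Fi => [/measurable_EFinP].
have mG : measurable_fun setT G by move/integrableP : Gi => [/measurable_EFinP].
pose h (z : measurableTypeR R * measurableTypeR R) : R :=
  if z.2 <= z.1 then F z.1 * G z.2 else 0.
have mh : measurable_fun setT h.
  apply: measurable_fun_ifT.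
  - by apply: measurable_fun_ler; [exact: measurable_snd|exact: measurable_fst].
  - apply: measurable_funM.
    + by apply: (measurableT_comp mF); exact: measurable_fst.
    + by apply: (measurableT_comp mG); exact: measurable_snd.
  - exact: measurable_cst.
have hi : (mu \x mu)%E.-integrable setT (EFin \o h).
  apply/integrable12ltyP; first exact/measurable_EFinP.
  (* Dropping the cut-off, [h] is dominated by the product of [F] and [G] in separate variables,
     whose iterated integral is a product of two finite integrals. *)
  apply: (@le_lt_trans _ _ (\int[mu]_x (`|F x|%:E * \int[mu]_y `|G y|%:E))%E).
    apply: ge0_le_integral => //.
    - by move=> x _; exact: integral_ge0.
    - have mah : measurable_fun setT (fun z => `|(EFin \o h) z|%E).
        by apply/measurableT_comp => //; exact/measurable_EFinP.
      by apply: (measurable_fun_fubini_tonelli_F (m2 := mu) (fun z => `|(EFin \o h) z|%E)).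
    - apply: emeasurable_funM; last exact: measurable_cst.
      exact/measurable_EFinP/measurableT_comp.
    - move=> x _; rewrite -ge0_integralZl//; last first.
        exact/measurable_EFinP/measurableT_comp.
      apply: ge0_le_integral => //.
      + apply/measurable_EFinP/measurableT_comp => //.
        by apply: (measurableT_comp mh); exact: pair1_measurable.
      + apply/measurable_EFinP/measurable_funM => //; exact: measurableT_comp.
      + move=> y _; rewrite lee_fin /h /=; case: ifP => _; first by rewrite normrM.
        by rewrite normr0 mulr_ge0.
  have /integrableP[_ Foo] := Fi; have /integrableP[_ Goo] := Gi.
  rewrite ge0_integralZr//; last 2 first.
  - exact/measurable_EFinP/measurableT_comp.
  - exact: integral_ge0.
  by rewrite lte_mul_pinfty//; [exact: integral_ge0|rewrite ge0_fin_numE//; exact: integral_ge0].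
have i1 (s : R) : (\int[mu]_t (h (s, t))%:E)%E =
    (((fun s => f s * itg a s g) \_ `[a, b]) s)%:E.
  rewrite patchE; case: ifPn => [|sab].
    rewrite inE/= in_itv/= => /andP[as_ sb].
    have gs : integ a s g by exact: integS gi.
    rewrite EFinM -fine_itg// -integralZl//.
    rewrite [RHS]integral_mkcond; apply: eq_integral => t _ /=.
    rewrite /h /F /G /= !patchE !mem_setE !in_itv/= as_ sb/=.
    case: (leP a t) => /= [at_|ta]; last by rewrite mulr0; case: ifP.
    case: (leP t s) => //= ts.
    by rewrite (le_trans ts sb).
  rewrite (eq_integral (fun=> 0%E)) ?integral0// => t _.
  by rewrite /h /F /= patchE (negbTE sab) mul0r; case: ifP.
have i2 (t : R) : (\int[mu]_s (h (s, t))%:E)%E =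
    (((fun t => itg t b f * g t) \_ `[a, b]) t)%:E.
  rewrite patchE; case: ifPn => [|tab].
    rewrite inE/= in_itv/= => /andP[at_ tb].
    have ft : integ t b f by exact: integS fi.
    rewrite mulrC EFinM -fine_itg// -integralZl//.
    rewrite [RHS]integral_mkcond; apply: eq_integral => s _ /=.
    rewrite /h /F /G /= !patchE !mem_setE !in_itv/= at_ tb/=.
    case: (leP t s) => //= ts.
    rewrite (le_trans at_ ts)/=.
    by case: (leP s b) => //= sb; rewrite ?mul0r// mulrC.
  rewrite (eq_integral (fun=> 0%E)) ?integral0// => s _.
  by rewrite /h /G /= patchE (negbTE tab) mulr0; case: ifP.
rewrite !itg_patch /Rintegral; congr fine.
transitivity (\int[mu]_s \int[mu]_t (EFin \o h) (s, t))%E.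
  by apply: eq_integral => s _ /=; rewrite i1.
by rewrite (Fubini hi); apply: eq_integral => t _ /=; rewrite i2.
Qed.

End Fubini_triangle.

(* [F] is absolutely continuous on [`[a, b]] with almost everywhere derivative [f]. *)
Definition ac (R : realType) (a b : R) (F f : R -> R) : Prop :=
  integ a b f /\ forall x, a <= x <= b -> F x = F a + itg a x f.

Section AbsolutelyContinuous.
Context {R : realType}.
Implicit Types (a b c d k x y : R) (f g F G : R -> R).

Lemma AC_integ a b F f : ac a b F f -> integ a b f.
Proof. by case. Qed.

Lemma AC_itg a b F f x y : ac a b F f -> a <= x -> x <= y -> y <= b ->
  F y = F x + itg x y f.
Proof.
move=> [fi Ff] ax xy yb; rewrite (Ff x) ?ax ?(le_trans xy yb)//.
rewrite (Ff y) ?yb ?(le_trans ax xy)// -addrA; congr (_ + _).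
by apply: itg_chasles => //; exact: integS fi.
Qed.

Lemma AC_wcont a b F f : ac a b F f -> wcont a b F.
Proof.
move=> [fi Ff]; have [ab|ba] := leP a b; last first.
  rewrite /wcont set_itv_ge ?bnd_simp -?ltNge//.
  by move=> x; apply: (@continuous_subspace0 _ _ F).
apply: (eq_wcont (f := fun x => F a + itg a x f)) => [x xab|]; first by rewrite -Ff.
apply: wcontD; first exact: wcont_cst.
exact: parameterized_integral_continuous.
Qed.

Lemma AC_itgP a b f : integ a b f -> ac a b (fun x => itg a x f) f.
Proof. by move=> fi; split => // x _; rewrite itg_pt add0r. Qed.

Lemma eq_AC a b F G f g : (forall x, a <= x <= b -> F x = G x) ->
  (forall x, a <= x <= b -> f x = g x) -> ac a b F f -> ac a b G g.
Proof.
move=> FG fg [fi Ff]; split; first exact: eq_integ fi.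
move=> x /[dup] xab /andP[ax xb]; rewrite -!FG ?lexx ?ax ?xb ?(le_trans ax xb)//.
rewrite Ff//; congr (_ + _); apply: eq_itg => y /andP[ay yx].
by apply: fg; rewrite ay (le_trans yx xb).
Qed.

Lemma ACD a b F G f g : ac a b F f -> ac a b G g ->
  ac a b (fun x => F x + G x) (fun x => f x + g x).
Proof.
move=> [fi Ff] [gi Gg]; split; first exact: integD.
move=> x /[dup] /andP[ax xb] xab; rewrite Ff// Gg//.
rewrite itgD; [by ring|exact: integS fi|exact: integS gi].
Qed.

Lemma ACZ a b k F f : ac a b F f -> ac a b (fun x => k * F x) (fun x => k * f x).
Proof.
move=> [fi Ff]; split; first exact: integZ.
move=> x /[dup] /andP[ax xb] xab; rewrite Ff//.
rewrite itgZ; [by ring|exact: integS fi].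
Qed.

Lemma ACN a b F f : ac a b F f -> ac a b (fun x => - F x) (fun x => - f x).
Proof. by move/(ACZ (-1)); apply: eq_AC => x _; rewrite mulN1r. Qed.

Lemma ACB a b F G f g : ac a b F f -> ac a b G g ->
  ac a b (fun x => F x - G x) (fun x => f x - g x).
Proof. by move=> FA GA; apply: ACD => //; exact: ACN. Qed.

Lemma AC_cst a b k : ac a b (fun=> k) (fun=> 0).
Proof.
split=> [|x /andP[ax _]]; first exact/integ_cont/wcont_cst.
by rewrite itg_cst// mul0r addr0.
Qed.

Lemma ACS a b c d F f : a <= c -> d <= b -> ac a b F f -> ac c d F f.
Proof.
move=> ac db FA; split; first exact: integS (AC_integ FA).
move=> x /andP[cx xd]; exact: (AC_itg FA ac cx (le_trans xd db)).
Qed.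

(** One factor is expanded from the left end and the other from the right end; the two double
    integrals over the triangle that remain cancel by [itg_triangle]. No pointwise derivative is
    involved. *)
Lemma ACM a b F G f g : ac a b F f -> ac a b G g ->
  ac a b (fun x => F x * G x) (fun x => f x * G x + F x * g x).
Proof.
move=> FA GA; have [fi Ff] := FA; have [gi Gg] := GA.
have cF := AC_wcont FA; have cG := AC_wcont GA.
have fGi : integ a b (fun x => f x * G x).
  by apply: eq_integ (integMc cG fi) => x _; rewrite mulrC.
have Fgi : integ a b (fun x => F x * g x) by exact: integMc.
split; first exact: integD.
move=> x /andP[ax xb].
have {}FA := ACS (lexx a) xb FA; have {}GA := ACS (lexx a) xb GA.
have {}fi := AC_integ FA; have {}gi := AC_integ GA.
have iG : integ a x (fun s => f s * itg a s g).
  apply: eq_integ (integMc (AC_wcont (AC_itgP gi)) fi) => s _; exact: mulrC.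
have iF : integ a x (fun s => itg s x f * g s).
  apply: (eq_integ (f := fun s => (F x - F s) * g s)).
    by move=> s /andP[as_ sx]; rewrite (AC_itg FA as_ sx (lexx x)); ring.
  by apply: integMc => //; apply: wcontB; [exact: wcont_cst|exact: AC_wcont FA].
rewrite itgD; last 2 first.
- exact: integS fGi.
- exact: integS Fgi.
have -> : itg a x (fun s => f s * G s) =
    G a * itg a x f + itg a x (fun s => f s * itg a s g).
  rewrite -itgZ// -itgD//; last exact: integZ.
  by apply: eq_itg => s /andP[as_ sx]; rewrite (AC_itg GA (lexx a) as_ sx); ring.
have -> : itg a x (fun s => F s * g s) =
    F x * itg a x g - itg a x (fun s => itg s x f * g s).
  rewrite -itgZ// -itgB//; last exact: integZ.
  by apply: eq_itg => s /andP[as_ sx]; rewrite (AC_itg FA as_ sx (lexx x)); ring.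
rewrite (itg_triangle fi gi).
by rewrite (AC_itg FA (lexx a) ax (lexx x)) (AC_itg GA (lexx a) ax (lexx x)); ring.
Qed.

Lemma wcont_in a b f x : wcont a b f -> a < x -> x < b -> {for x, continuous f}.
Proof.
move=> cf ax xb; have ab := lt_trans ax xb.
have [+ _ _] := (continuous_within_itvP f ab).1 cf.
by apply; rewrite in_itv/= ax.
Qed.

Lemma near_itvoo a b x : a < x -> x < b -> \forall y \near x, a < y < b.
Proof.
move=> ax xb; have : x \in `]a, b[ by rewrite in_itv/= ax.
by move/near_in_itvoo; apply: filterS => y; rewrite in_itv.
Qed.

Lemma AC_derive a b F f x : ac a b F f -> wcont a b f -> a < x -> x < b ->
  is_derive x 1 F (f x).
Proof.
move=> FA cf ax xb; have [fi Ff] := FA.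
have [|] := @continuous_FTC1_closed R f a x b xb fi ax.
  exact: wcont_in cf ax xb.
move=> dI dE; apply: (@near_eq_is_derive _ _ _ (fun y => itg a y f + F a)).
  near=> y; have /andP[ay yb] : a < y < b by near: y; exact: near_itvoo.
  by rewrite addrC -Ff// ltW//= ltW.
have : is_derive x 1 (fun y => itg a y f) (f x).
  by apply: DeriveDef; [exact: dI|rewrite -derive1E; exact: dE].
move=> h; have := @is_deriveD _ _ _ _ _ _ _ _ _ h (@is_derive_cst _ _ _ (F a) x 1).
by rewrite addr0.
Unshelve. all: by end_near. Qed.

Lemma AC_smooth a b F f : a <= b -> wcont a b F -> wcont a b f ->
  (forall x, a < x -> x < b -> is_derive x 1 F (f x)) -> ac a b F f.
Proof.
move=> ab cF cf Ff; split; first exact: integ_cont.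
move=> x /andP[]; rewrite le_eqVlt => /predU1P[<- _|ax xb].
  by rewrite itg_pt addr0.
rewrite /itg /Rintegral (@continuous_FTC2 R f F a x ax).
- by rewrite -EFinB/= addrC subrK.
- exact: (wcontS (lexx a) xb cf).
- have [h1 h2 h3] := (continuous_within_itvP F ax).1 (wcontS (lexx a) xb cF).
  split => // y; rewrite in_itv/= => /andP[ay yx].
  by have [] := Ff _ ay (lt_le_trans yx xb).
- move=> y; rewrite in_itv/= => /andP[ay yx]; rewrite derive1E.
  by have [_ ->] := Ff _ ay (lt_le_trans yx xb).
Qed.

Lemma AC_C1 a b F f : a <= b -> continuous f ->
  (forall x, is_derive x 1 F (f x)) -> ac a b F f.
Proof.
move=> ab cf Ff; apply: AC_smooth => //; apply: wcontT => // x.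
by apply/differentiable_continuous/derivable1_diffP; have [] := Ff x.
Qed.

End AbsolutelyContinuous.

(** * Test functions and the du Bois-Reymond lemma *)

Section TestFunctions.
Context {R : realType}.
Implicit Types (a b c d k w x y : R) (f g h phi : R -> R).

Lemma derivable_continuous f : (forall x, derivable f x 1) -> continuous f.
Proof. by move=> df x; apply/differentiable_continuous/derivable1_diffP. Qed.

Lemma is_derive_affine w c x : is_derive x 1 (fun x => w * x + c) w.
Proof.
have : is_derive x 1 (fun x : R => w *: x + c : R) (w *: (1:R) + 0).
  by apply: is_deriveD.
by rewrite addr0 /GRing.scale/= mulr1.
Qed.

Lemma is_derive_cos_affine w c x :
  is_derive x 1 (fun x => cos (w * x + c)) (- w * sin (w * x + c)).
Proof.
have := @is_derive1_comp R cos (fun x => w * x + c) x _ _ (is_derive_cos _) (is_derive_affine w c x).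
by rewrite mulNr mulrC -mulNr mulrC.
Qed.

Lemma is_derive_sin_affine w c x :
  is_derive x 1 (fun x => sin (w * x + c)) (w * cos (w * x + c)).
Proof.
have := @is_derive1_comp R sin (fun x => w * x + c) x _ _ (is_derive_sin _) (is_derive_affine w c x).
by rewrite mulrC.
Qed.

Lemma is_derive_scale f k x d : is_derive x 1 f d -> is_derive x 1 (fun x => k * f x) (k * d).
Proof. by move=> fd; have := is_deriveZ k fd. Qed.

Lemma is_derive_derive1 f x d : is_derive x 1 f d -> derive1 f x = d.
Proof. by move=> [_ <-]; rewrite derive1E. Qed.

(** Each derivative shifts the phase by a quarter turn, so one closed form serves all orders and
    gives the smoothness of the test functions. *)
Lemma derive1n_cos_affine n (k w c : R) : derive1n n (fun x => k * cos (w * x + c)) =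
  fun x => k * w ^+ n * cos (w * x + (c + (pi / 2) *+ n)).
Proof.
elim: n => [|n IH]; first by rewrite derive1n0 expr0 mulr1 mulr0n addr0.
rewrite derive1nS IH; apply/funext => x.
rewrite (is_derive_derive1 (is_derive_scale _ (is_derive_cos_affine _ _ x))).
by rewrite (mulrSr (pi / 2)) [c + (_ + _)]addrA [w * x + (_ + pi / 2)]addrA cosDpihalf exprSr; ring.
Qed.

Lemma test_function_cos (n : nat) (k c : R) : test_function (fun x => k * cos (n%:R * x + c)).
Proof.
split=> [x|m x].
  have -> : n%:R * (x + 2 * pi) + c = n%:R * x + c + (pi *+ 2) *+ n.
    by rewrite -[_ *+ n]mulr_natl mulr2n; ring.
  by rewrite (periodicn (@cosD2pi R)).
rewrite derive1n_cos_affine.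
by have [] := is_derive_scale (k * n%:R ^+ m) (is_derive_cos_affine n%:R (c + pi / 2 *+ m) x).
Qed.

Lemma test_function_cst k : test_function (fun=> k : R).
Proof.
have -> : (fun=> k : R) = fun x => k * cos (0%:R * x + 0).
  by apply/funext => x; rewrite mul0r add0r cos0 mulr1.
exact: test_function_cos.
Qed.

Lemma periodic_derive1 f T : periodic f T -> periodic (derive1 f) T.
Proof.
move=> fT x; rewrite /derive1.
suff -> : (fun t => t^-1 *: (f (t + (x + T)) - f (x + T))) =
  (fun t => t^-1 *: (f (t + x) - f x)) by [].
by apply/funext => t; rewrite addrA !fT.
Qed.

Lemma test_function_derive1 phi : test_function phi -> test_function (derive1 phi).
Proof.
move=> [pp dp]; split; first exact: periodic_derive1.
by move=> n x; have := dp n.+1 x; rewrite /derive1n iterSr.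
Qed.

Lemma test_function_is_derive phi x : test_function phi -> is_derive x 1 phi (derive1 phi x).
Proof.
move=> [_ /(_ 0 x)]; rewrite derive1n0 => dp.
by apply: DeriveDef; [exact: dp|rewrite derive1E].
Qed.

Lemma test_function_continuous phi : test_function phi -> continuous phi.
Proof. by move=> tp; apply: derivable_continuous => x; have [] := test_function_is_derive x tp. Qed.

Lemma test_function_AC a b phi : a <= b -> test_function phi -> ac a b phi (derive1 phi).
Proof.
move=> ab tp; apply: AC_C1 => //.
  exact/test_function_continuous/test_function_derive1.
by move=> x; exact: test_function_is_derive.
Qed.

Lemma test_function_period phi : test_function phi -> phi (2 * pi) = phi 0.
Proof. by move=> [pp _]; rewrite -[2 * pi]add0r pp. Qed.

End TestFunctions.

(** * Cosine kernels concentrating at a point *)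

Section Orthogonality.
Context {R : realType}.
Implicit Types (a b c d k w x y : R) (f g h phi : R -> R).

Lemma bernoulli_ineq (t : R) n : 0 <= t -> 1 + n%:R * t <= (1 + t) ^+ n.
Proof.
move=> t0; elim: n => [|n IH]; first by rewrite mul0r addr0 expr0.
rewrite exprS; apply: (@le_trans _ _ ((1 + t) * (1 + n%:R * t))).
  rewrite -natr1; have := mulr_ge0 (mulr_ge0 (ler0n R n) t0) t0; lra.
by rewrite ler_wpM2l// addr_ge0.
Qed.

Lemma exprn_unbounded (q M : R) : 1 < q -> exists n, M < q ^+ n.
Proof.
move=> q1; have t0 : 0 < q - 1 by rewrite subr_gt0.
exists (Num.truncn (`|M| / (q - 1))).+1.
have := bernoulli_ineq (Num.truncn (`|M| / (q - 1))).+1 (ltW t0).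
rewrite [1 + (q - 1)]addrC subrK; apply: lt_le_trans.
have := truncnS_gt (`|M| / (q - 1)); rewrite ltr_pdivrMr// => h.
have := ler_norm M; lra.
Qed.

(* The kernel [(1 - cos d + cos (x - y)) ^+ n] blows up near [y] and stays
   bounded by [1] at distance at least [d] from [y]. *)
Lemma cosine_kernel_concentration g y : wcont 0 (2 * pi) g -> 0 < y -> y < 2 * pi -> 0 < g y ->
  exists a n, 0 < itg 0 (2 * pi) (fun x => g x * (a + cos (x - y)) ^+ n).
Proof.
move=> cg y0 y2 gy0.
have pi0 := @pi_gt0 R.
have [d0 d00 gd] : exists2 d0 : R, 0 < d0 & forall x, `|x - y| < d0 -> g y / 2 < g x.
  have /cvgrPdist_lt /(_ (g y / 2)) := wcont_in cg y0 y2.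
  rewrite divr_gt0// => /(_ isT) [e /= e0 he]; exists e => // x xy.
  have := he x; rewrite /ball_/= distrC => /(_ xy).
  rewrite ltr_distl => /andP[_]; lra.
(* The window of radius [d] around [y] lies in the period and in the region where [g] exceeds
   [g y / 2], and cosine is decreasing on [[0, d]]. *)
pose d : R := Num.min (Num.min (d0 / 2) (pi / 2)) (Num.min y (2 * pi - y)).
have dle : [/\ d <= d0 / 2, d <= pi / 2, d <= y & d <= 2 * pi - y].
  by rewrite /d !ge_min !lexx ?orbT.
have d_gt0 : 0 < d by rewrite /d !lt_min !divr_gt0//= y0 subr_gt0.
have [dd0 dpi dy d2y] := dle.
have cos_le (u v : R) : 0 <= u -> u <= v -> v <= pi -> cos v <= cos u.
  move=> u0; rewrite le_eqVlt => /predU1P[->//|uv] vp.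
  by apply: ltW; rewrite ltr_cos ?in_itv/= ?u0 ?vp ?(le_trans u0 (ltW uv))// (le_trans (ltW uv) vp).
pose q (x : R) : R := 1 - cos d + cos (x - y).
pose r : R := 1 - cos d + cos (d / 2).
have r1 : 1 < r.
  have : cos d < cos (d / 2) by rewrite ltr_cos ?in_itv/=; lra.
  rewrite /r; lra.
have qcos x : cos (x - y) = cos `|x - y| by rewrite cos_norm.
have q_near x : `|x - y| <= d / 2 -> r <= q x.
  move=> xy; rewrite /q /r lerD2l qcos; apply: cos_le => //; lra.
have q_mid x : `|x - y| <= d -> 0 <= q x.
  move=> xy; rewrite /q qcos; have := @cos_le _ _ (normr_ge0 (x - y)) xy.
  move=> /(_ ltac:(lra)); lra.
have q_far x : 0 <= x <= 2 * pi -> d <= `|x - y| -> `|q x| <= 1.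
  move=> /andP[x0 x2] xy.
  have hc : cos (x - y) <= cos d.
    (* Past [pi] the cosine increases again; the comparison is then made at [2 * pi - |x - y|],
       which is at least [d] because [d <= y] and [d <= 2 * pi - y]. *)
    rewrite qcos; have [xp|xp] := leP `|x - y| pi; first by apply: cos_le => //; lra.
    rewrite -[cos `|x - y|]cosN -(@cosD2pi R) mulr2n; apply: cos_le; first lra.
    + have : `|x - y| <= 2 * pi - d; last lra.
      by rewrite ler_norml; lra.
    + lra.
  have := cos_geN1 (x - y); have := cos_le1 d; rewrite ler_norml /q; lra.
have [M M0 gM] := wcont_bounded cg.
(* The window of width [d] contributes at least [g y / 2 * r ^+ n * d]; this must beat the loss
   outside it, at most [2 * pi * M]. *)
have [n hn] := @exprn_unbounded r ((2 * pi * M) / (g y / 2 * d)) r1.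
exists (1 - cos d), n; rewrite -/(q _).
have cq : wcont 0 (2 * pi) (fun x => g x * q x ^+ n).
  apply: wcontM => //; apply: wcontX; apply: wcontD; first exact: wcont_cst.
  apply: (wcont_comp (g := cos)); last exact: continuous_cos.
  by apply: wcontB; [exact: wcont_id|exact: wcont_cst].
have lower x : 0 <= x <= 2 * pi -> - M <= g x * q x ^+ n.
  move=> x02; have [xd|xd] := leP `|x - y| d.
    apply: (@le_trans _ _ 0); first by rewrite oppr_le0.
    apply: mulr_ge0; last by rewrite exprn_ge0// q_mid.
    have := gd x; move=> /(_ ltac:(lra)); lra.
  have : `|g x * q x ^+ n| <= M * 1.
    by rewrite normrM normrX ler_pM// ?exprn_ge0// ?gM// exprn_ile1// q_far// ltW.
  by rewrite mulr1 ler_norml => /andP[].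
have upper x : y - d / 2 <= x <= y + d / 2 -> g y / 2 * r ^+ n <= g x * q x ^+ n.
  move=> /andP[x1 x2]; have xy : `|x - y| <= d / 2 by rewrite ler_norml; lra.
  apply: ler_pM.
  - lra.
  - by rewrite exprn_ge0//; lra.
  - by apply/ltW/gd; lra.
  - by rewrite lerXn2r ?nnegrE ?q_near//; have := q_near _ xy; lra.
have iq := integ_cont cq.
have part u v k : 0 <= u -> u <= v -> v <= 2 * pi ->
    (forall x, u <= x <= v -> k <= g x * q x ^+ n) ->
    k * (v - u) <= itg u v (fun x => g x * q x ^+ n).
  move=> u0 uv v2 hk; rewrite -itg_cst//; apply: le_itg => //.
    exact/integ_cont/wcont_cst.
  exact: integS iq.
rewrite (@itg_chasles _ _ _ (y - d / 2))//; [|lra|lra].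
rewrite (@itg_chasles _ (y - d / 2) _ (y + d / 2))//; [|lra|lra|by apply: integS iq; lra].
have h1 := @part 0 (y - d / 2) (- M) (lexx _) ltac:(lra) ltac:(lra).
have h2 := @part (y - d / 2) (y + d / 2) (g y / 2 * r ^+ n) ltac:(lra) ltac:(lra) ltac:(lra) upper.
have h3 := @part (y + d / 2) (2 * pi) (- M) ltac:(lra) ltac:(lra) ltac:(lra).
have {}h1 := h1 (fun x xh => lower x ltac:(lra)).
have {}h3 := h3 (fun x xh => lower x ltac:(lra)).
move: hn; rewrite ltr_pdivrMr => [hn|]; last by rewrite mulr_gt0// divr_gt0.
have : 0 <= M * d by rewrite mulr_ge0// ltW.
move: hn h1 h2 h3; lra.
Qed.

End Orthogonality.

(** * Orthogonality to second derivatives of test functions *)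

Section DuBoisReymond.
Context {R : realType}.
Implicit Types (a b c d k w x y : R) (f g h phi : R -> R).

Lemma wcont_cos a b w c : wcont a b (fun x => cos (w * x + c)).
Proof.
apply: wcontT; apply: derivable_continuous => x.
by have [] := is_derive_cos_affine w c x.
Qed.

Lemma wcont_eq0 a b h : a < b -> wcont a b h -> (forall x, a < x -> x < b -> h x = 0) ->
  forall x, a <= x <= b -> h x = 0.
Proof.
move=> ab ch h0 x /andP[]; have [_ ca cb] := (continuous_within_itvP h ab).1 ch.
rewrite le_eqVlt => /predU1P[<- _|ax].
  have : h t @[t --> a^'+] --> (0 : R).
    apply: cvg_near_cst; near=> t; apply: h0.
      by near: t; exact: nbhs_right_gt.
    by near: t; exact: nbhs_right_lt.
  exact: (cvg_unique _ ca).
rewrite le_eqVlt => /predU1P[->|xb]; last exact: h0.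
have : h t @[t --> b^'-] --> (0 : R).
  apply: cvg_near_cst; near=> t; apply: h0.
    by near: t; exact: nbhs_left_gt.
  by near: t; exact: nbhs_left_lt.
exact: (cvg_unique _ cb).
Unshelve. all: by end_near. Qed.

Lemma itg_cos_period (n : nat) c : itg 0 (2 * pi) (fun x => cos (n.+1%:R * x + c)) = 0.
Proof.
have n0 : n.+1%:R != 0 :> R by rewrite pnatr_eq0.
have A : ac 0 (2 * pi) (fun x => sin (n.+1%:R * x + c)) (fun x => n.+1%:R * cos (n.+1%:R * x + c)).
  apply: AC_C1; first by rewrite mulr_ge0// pi_ge0.
    apply: derivable_continuous => x.
    by have [] := is_derive_scale n.+1%:R (is_derive_cos_affine n.+1%:R c x).
  by move=> x; exact: is_derive_sin_affine.
have p0 : (0 : R) <= 2 * pi by rewrite mulr_ge0// pi_ge0.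
have := AC_itg A (lexx _) p0 (lexx _).
have -> : n.+1%:R * (2 * pi) + c = n.+1%:R * 0 + c + (pi *+ 2) *+ n.+1 :> R.
  by rewrite -[_ *+ n.+1]mulr_natl mulr2n; ring.
rewrite (periodicn (@sinD2pi R)) itgZ; last exact/integ_cont/wcont_cos.
rewrite -[X in X = _]addr0 => /addrI/esym/eqP.
by rewrite mulf_eq0 (negbTE n0) => /eqP.
Qed.

(* The trigonometric polynomials [(a + cos (x - y)) ^+ n] are, up to a constant,
   second derivatives of test functions. *)
Lemma orthogonal_second_derivatives_cst h : wcont 0 (2 * pi) h ->
  (forall phi, test_function phi ->
     itg 0 (2 * pi) (fun x => h x * derive1 (derive1 phi) x) = 0) ->
  exists m, forall x, 0 <= x <= 2 * pi -> h x = m.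
Proof.
move=> ch horth.
have p0 : (0 : R) < 2 * pi by rewrite mulr_gt0// pi_gt0.
(* Removing the mean gives orthogonality at frequency [0], the only integer frequency whose cosines
   need not be second derivatives of test functions. *)
pose m := itg 0 (2 * pi) h / (2 * pi); pose h0 x := h x - m.
have ch0 : wcont 0 (2 * pi) h0 by apply: wcontB => //; exact: wcont_cst.
have h0c w c : wcont 0 (2 * pi) (fun x => h0 x * cos (w * x + c)).
  by apply: wcontM => //; exact: wcont_cos.
have orth_nat (n : nat) c : itg 0 (2 * pi) (fun x => h0 x * cos (n%:R * x + c)) = 0.
  case: n => [|n].
    rewrite (eq_itg (g := fun x => cos c * (h x - m))); last first.
      by move=> x _; rewrite mul0r add0r mulrC.
    rewrite itgZ; last exact: integ_cont.
    rewrite itgB; [|exact: integ_cont|exact/integ_cont/wcont_cst].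
    by rewrite itg_cst ?ltW// subr0 divfK ?gt_eqF// subrr mulr0.
  have n0 : n.+1%:R != 0 :> R by rewrite pnatr_eq0.
  pose phi x : R := - (n.+1%:R ^- 2) * cos (n.+1%:R * x + c).
  have phi2 x : derive1 (derive1 phi) x = cos (n.+1%:R * x + c).
    have -> : derive1 (derive1 phi) = derive1n 2 phi by [].
    rewrite derive1n_cos_affine mulNr mulVf ?expf_neq0// mulN1r.
    by rewrite mulr2n addrA addrA !cosDpihalf sinDpihalf opprK.
  have := horth phi (test_function_cos _ _ _).
  under eq_itg do rewrite phi2.
  move=> hc; rewrite (eq_itg (g := fun x => h x * cos (n.+1%:R * x + c) - m * cos (n.+1%:R * x + c))).
    rewrite itgB ?hc ?itgZ ?itg_cos_period ?mulr0 ?subr0//.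
    - exact/integ_cont/wcont_cos.
    - by apply/integ_cont/wcontM => //; exact: wcont_cos.
    - by apply/integZ/integ_cont/wcont_cos.
  by move=> x _; rewrite /h0 mulrBl.
have orth_int (z : int) c : itg 0 (2 * pi) (fun x => h0 x * cos (z%:~R * x + c)) = 0.
  case: z => n; first exact: orth_nat.
  rewrite -[RHS](orth_nat n.+1 (- c)); apply: eq_itg => x _.
  by rewrite -cosN NegzE mulrNz; congr (_ * cos _); ring.
(* The extra cosine factor makes the induction close: product-to-sum absorbs one kernel factor and
   moves the frequency by one either way. This is why frequencies range over all integers. *)
have orth_pow a y n (z : int) c :
    itg 0 (2 * pi) (fun x => h0 x * (cos (z%:~R * x + c) * (a + cos (x - y)) ^+ n)) = 0.
  elim: n z c => [|n IH] z c.
    rewrite -[RHS](orth_int z c); apply: eq_itg => x _.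
    by rewrite expr0 mulr1.
  have ck (v : int) e : integ 0 (2 * pi)
      (fun x => h0 x * (cos (v%:~R * x + e) * (a + cos (x - y)) ^+ n)).
    apply/integ_cont/wcontM => //; apply: wcontM; first exact: wcont_cos.
    apply: wcontX; apply: wcontD; first exact: wcont_cst.
    apply: (wcont_comp (g := cos)); last exact: continuous_cos.
    by apply: wcontB; [exact: wcont_id|exact: wcont_cst].
  rewrite (eq_itg (g := fun x => a * (h0 x * (cos (z%:~R * x + c) * (a + cos (x - y)) ^+ n))
    + (2^-1 * (h0 x * (cos ((z + 1)%:~R * x + (c - y)) * (a + cos (x - y)) ^+ n))
    + 2^-1 * (h0 x * (cos ((z - 1)%:~R * x + (c + y)) * (a + cos (x - y)) ^+ n))))).
    rewrite itgD ?itgD ?itgZ ?IH ?mulr0 ?addr0//; [exact: integZ|exact: integZ|exact: integZ|].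
    by apply: integD; exact: integZ.
  move=> x _; rewrite exprS.
  have -> : (z + 1)%:~R * x + (c - y) = (z%:~R * x + c) + (x - y) by rewrite intrD; ring.
  have -> : (z - 1)%:~R * x + (c + y) = (z%:~R * x + c) - (x - y) by rewrite intrB; ring.
  by rewrite (cosD (z%:~R * x + c) (x - y)) (cosB (z%:~R * x + c) (x - y)); field.
have kernel0 a y n : itg 0 (2 * pi) (fun x => h0 x * (a + cos (x - y)) ^+ n) = 0.
  rewrite -[RHS](orth_pow a y n 0 0); apply: eq_itg => x _.
  by rewrite mul0r add0r cos0 mul1r.
exists m => x x02; apply/eqP; rewrite -subr_eq0; apply/eqP.
(* Concentration is available at interior points only, so the ends are reached by continuity. A
   positive value contradicts the kernel for [h0], a negative one the kernel for [- h0]. *)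
apply: (wcont_eq0 p0 ch0 _ x02) => y y0 y2; apply/eqP; rewrite eq_le !leNgt.
apply/andP; split; apply/negP => hy.
  by have [a [n]] := cosine_kernel_concentration ch0 y0 y2 hy; rewrite kernel0 ltxx.
have gy : 0 < (fun x => - h0 x) y by rewrite oppr_gt0.
have [a [n]] := cosine_kernel_concentration (wcontN ch0) y0 y2 gy.
rewrite (eq_itg (g := fun x => (-1) * (h0 x * (a + cos (x - y)) ^+ n))) => [|u _]; last by ring.
rewrite itgZ ?kernel0 ?mulr0 ?ltxx//.
apply/integ_cont/wcontM => //; apply: wcontX; apply: wcontD; first exact: wcont_cst.
apply: (wcont_comp (g := cos)); last exact: continuous_cos.
by apply: wcontB; [exact: wcont_id|exact: wcont_cst].
Qed.

End DuBoisReymond.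

(** * Weak derivatives *)

Section WeakDerivatives.
Context {R : realType}.
Implicit Types (a b c d k w x y : R) (f g h phi : R -> R).
Notation mu := (@lebesgue_measure R).

Lemma twopi_gt0 : 0 < 2 * pi :> R.
Proof. by rewrite mulr_gt0// pi_gt0. Qed.

Lemma L1_circle_integ f : L1_circle f -> integ 0 (2 * pi) f.
Proof.
move=> /Lfun1_integrable; rewrite -restrict_EFin => fi.
suff : mu.-integrable (setT `&` period R) (EFin \o f) by rewrite setTI.
have mT : measurable [set: measurableTypeR R] by [].
have mP : measurable (period R : set (measurableTypeR R)) by rewrite /period; exact: measurable_itv.
exact: (integrable_restrict mu mP mT (EFin \o f)).2 fi.
Qed.

Lemma L2_circle_integ_sqr f : L2_circle f -> integ 0 (2 * pi) (fun x => f x ^+ 2).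
Proof.
move=> /Lfun2_integrable_sqr fi.
have : mu.-integrable `[0, 2 * pi] (EFin \o (fun x => (f \_ (period R)) x ^+ 2)).
  exact: integrableS fi.
by apply: eq_integ => x x02; rewrite patchE mem_set// /period/= in_itv.
Qed.

Lemma circle_int_itg f : circle_int f = itg 0 (2 * pi) f.
Proof. by []. Qed.

Lemma weak_derivative_mean0 f g : weak_derivative f g -> itg 0 (2 * pi) g = 0.
Proof.
move=> [_ _ /(_ (fun=> 1) (test_function_cst 1))]; rewrite !circle_int_itg.
rewrite (eq_itg (g := fun=> 0)) => [|x _]; last by rewrite derive1_cst mulr0.
rewrite itg_cst ?ltW ?twopi_gt0// mul0r (eq_itg (g := g)) => [|x _]; last by rewrite mulr1.
by move=> /eqP; rewrite eq_sym oppr_eq0 => /eqP.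
Qed.

Lemma ac_test f g phi : ac 0 (2 * pi) f g -> f (2 * pi) = f 0 -> test_function phi ->
  itg 0 (2 * pi) (fun x => f x * derive1 phi x) = - itg 0 (2 * pi) (fun x => g x * phi x).
Proof.
move=> fA f2 tp; have p0 := ltW twopi_gt0.
have pA := test_function_AC p0 tp.
have := AC_itg (ACM fA pA) (lexx _) p0 (lexx _).
rewrite f2 (test_function_period tp) -[X in X = _ -> _]addr0 => /addrI.
rewrite itgD; last 2 first.
- apply: eq_integ (integMc (AC_wcont pA) (AC_integ fA)) => x _; exact: mulrC.
- exact: integMc (AC_wcont fA) (AC_integ pA).
by move=> /esym/eqP; rewrite addr_eq0 => /eqP ->; rewrite opprK.
Qed.

Lemma test_integ g phi : integ 0 (2 * pi) g -> test_function phi ->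
  integ 0 (2 * pi) (fun x => g x * phi x).
Proof.
move=> gi tp; apply: eq_integ (integMc (wcontT (test_function_continuous tp)) gi) => x _.
exact: mulrC.
Qed.

(** The function [f] minus the primitive of [g] is orthogonal to derivatives of test functions, in
    particular to second ones, hence constant. Testing with [1] shows that [g] has mean zero, so its
    primitive is periodic. *)
Lemma weak_derivative_ac f g : wcont 0 (2 * pi) f -> weak_derivative f g -> ac 0 (2 * pi) f g.
Proof.
move=> cf fg; have [fL gL hfg] := fg; have gi := L1_circle_integ gL.
have p0 := ltW twopi_gt0.
have GA := AC_itgP gi.
have G2 : itg 0 (2 * pi) g = itg 0 0 g by rewrite itg_pt (weak_derivative_mean0 fg).
have [||m hm] := @orthogonal_second_derivatives_cst R (fun x => f x - itg 0 x g).
- by apply: wcontB => //; exact: AC_wcont GA.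
- move=> phi /test_function_derive1 tp.
  rewrite (eq_itg (g := fun x => f x * derive1 (derive1 phi) x
    - itg 0 x g * derive1 (derive1 phi) x)) => [|x _]; last by rewrite mulrBl.
  have tp2 := test_function_derive1 tp.
  rewrite itgB; last 2 first.
  + exact: (test_integ (integ_cont cf) tp2).
  + exact: (test_integ (integ_cont (AC_wcont GA)) tp2).
  by rewrite (ac_test GA G2 tp) -!circle_int_itg hfg// subrr.
split=> // x x02.
have := hm 0; rewrite lexx p0 itg_pt subr0 => /(_ isT) ->.
by rewrite -(hm x x02) subrK.
Qed.

(** In [W22] the first weak derivative is just some [L2] representative, with no continuity to start
    from. It is bypassed by testing [f] against second derivatives, and the continuous derivative
    [F] is rebuilt from [g]. *)
Lemma weak_second_derivative_ac f g : wcont 0 (2 * pi) f -> integ 0 (2 * pi) g ->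
  (forall phi, test_function phi ->
    itg 0 (2 * pi) (fun x => f x * derive1 (derive1 phi) x) = itg 0 (2 * pi) (fun x => g x * phi x)) ->
  exists F, [/\ ac 0 (2 * pi) f F, ac 0 (2 * pi) F g & F (2 * pi) = F 0].
Proof.
move=> cf gi hfg; have p0 := ltW twopi_gt0.
have g0 : itg 0 (2 * pi) g = 0.
  have := hfg _ (test_function_cst 1).
  rewrite (eq_itg (g := fun=> 0)) => [|x _].
    rewrite itg_cst// mul0r (eq_itg (g := g)) => [//|x _]; by rewrite mulr1.
  have -> : derive1 (fun=> 1 : R) = fun=> 0 by apply/funext => y; rewrite derive1_cst.
  by rewrite derive1_cst mulr0.
(* The constant gives [F] mean zero, so that the primitive of [F] is periodic in its turn. *)
pose c := - itg 0 (2 * pi) (fun x => itg 0 x g) / (2 * pi).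
pose F x := itg 0 x g + c.
have FA : ac 0 (2 * pi) F g.
  apply: eq_AC (ACD (AC_itgP gi) (AC_cst _ _ c)) => // x _; exact: addr0.
have F2 : F (2 * pi) = F 0 by rewrite /F g0 itg_pt.
have Fi := integ_cont (AC_wcont FA).
have GA := AC_itgP Fi.
have F0 : itg 0 (2 * pi) F = 0.
  rewrite itgD; [|exact: integ_cont (AC_wcont (AC_itgP gi))|exact/integ_cont/wcont_cst].
  by rewrite itg_cst// subr0 /c divfK ?subrr// gt_eqF// twopi_gt0.
have G2 : itg 0 (2 * pi) F = itg 0 0 F by rewrite F0 itg_pt.
have [||m hm] := @orthogonal_second_derivatives_cst R (fun x => f x - itg 0 x F).
- by apply: wcontB => //; exact: AC_wcont GA.
- move=> phi tp; have tp1 := test_function_derive1 tp; have tp2 := test_function_derive1 tp1.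
  rewrite (eq_itg (g := fun x => f x * derive1 (derive1 phi) x
    - itg 0 x F * derive1 (derive1 phi) x)) => [|x _]; last by rewrite mulrBl.
  rewrite itgB; last 2 first.
  + exact: (test_integ (integ_cont cf) tp2).
  + exact: (test_integ (integ_cont (AC_wcont GA)) tp2).
  by rewrite (ac_test GA G2 tp1) (ac_test FA F2 tp) opprK hfg// subrr.
exists F; split => //; split=> // x x02.
have := hm 0; rewrite lexx p0 itg_pt subr0 => /(_ isT) ->.
by rewrite -(hm x x02) subrK.
Qed.

Lemma ac_slope_right a b f g : a < b -> ac a b f g -> wcont a b g ->
  t^-1 *: (f (t + a) - f a) @[t --> 0^'+] --> g a.
Proof.
move=> ab fA cg; have [_ ga _] := (continuous_within_itvP g ab).1 cg.
apply/cvgrPdist_le => /= e e0.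
have /cvgrPdist_le /(_ e e0) [d /= d0 hd] := ga.
near=> t.
have t0 : 0 < t by near: t; exact: nbhs_right_gt.
have tb : t < b - a by near: t; apply: nbhs_right_lt; rewrite subr_gt0.
have td : t < d by near: t; exact: nbhs_right_lt.
have gi : integ a (t + a) g by apply: (integS _ _ (AC_integ fA)) => //; lra.
rewrite (AC_itg fA (lexx a)) ?[_ + itg _ _ _]addrC ?addrK; [|lra|lra].
have bnd x : a <= x <= t + a -> `|g a - g x| <= e.
  move=> /andP[]; rewrite le_eqVlt => /predU1P[<- _|ax xt].
    by rewrite subrr normr0 ltW.
  apply: hd => //=; rewrite distrC gtr0_norm; lra.
have up : itg a (t + a) g <= (g a + e) * t.
  rewrite -[X in _ * X](addrK a) -itg_cst; [|lra].
  apply: le_itg => //; first exact/integ_cont/wcont_cst.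
  by move=> x /bnd; rewrite ler_distl; lra.
have lo : (g a - e) * t <= itg a (t + a) g.
  rewrite -[X in _ * X](addrK a) -itg_cst; [|lra].
  apply: le_itg => //; first exact/integ_cont/wcont_cst.
  by move=> x /bnd; rewrite ler_distl; lra.
rewrite /GRing.scale/= ler_distlC.
by rewrite mulrC ler_pdivlMr// ler_pdivrMr// lo.
Unshelve. all: by end_near. Qed.

Lemma ac_slope_left a b f g : a < b -> ac a b f g -> wcont a b g ->
  t^-1 *: (f (t + b) - f b) @[t --> 0^'-] --> g b.
Proof.
move=> ab fA cg; have [_ _ gb] := (continuous_within_itvP g ab).1 cg.
apply/cvgrPdist_le => /= e e0.
have /cvgrPdist_le /(_ e e0) [d /= d0 hd] := gb.
near=> t.
have t0 : t < 0 by near: t; exact: nbhs_left_lt.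
have tb : a - b < t by near: t; apply: nbhs_left_gt; rewrite subr_lt0.
have td : - d < t by near: t; apply: nbhs_left_gt; rewrite oppr_lt0.
have gi : integ (t + b) b g by apply: (integS _ _ (AC_integ fA)) => //; lra.
have -> : f (t + b) - f b = - itg (t + b) b g.
  by rewrite (AC_itg fA _ _ (lexx b) : _ = f (t + b) + _); [ring|lra|lra].
have bnd x : t + b <= x <= b -> `|g b - g x| <= e.
  move=> /andP[tx]; rewrite le_eqVlt => /predU1P[->|xb].
    by rewrite subrr normr0 ltW.
  apply: hd => //=; rewrite gtr0_norm; lra.
have up : itg (t + b) b g <= (g b + e) * - t.
  have -> : - t = b - (t + b) by ring.
  rewrite -itg_cst; [|lra].
  apply: le_itg => //; first exact/integ_cont/wcont_cst.
  by move=> x /bnd; rewrite ler_distl; lra.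
have lo : (g b - e) * - t <= itg (t + b) b g.
  have -> : - t = b - (t + b) by ring.
  rewrite -itg_cst; [|lra].
  apply: le_itg => //; first exact/integ_cont/wcont_cst.
  by move=> x /bnd; rewrite ler_distl; lra.
rewrite /GRing.scale/= mulrN -mulNr -invrN ler_distlC.
by rewrite mulrC ler_pdivlMr ?ler_pdivrMr ?oppr_gt0// lo.
Unshelve. all: by end_near. Qed.

(** At the ends of the period [derive1] is a two-sided limit, whereas the integral formula sees one
    side only. Periodicity moves the left slope at [2 * pi] to [0], where it meets the right slope
    because [g (2 * pi) = g 0]. *)
Lemma periodic_ac_derive1 f g : periodic f (2 * pi) ->
  ac 0 (2 * pi) f g -> wcont 0 (2 * pi) g -> g (2 * pi) = g 0 ->
  forall x, 0 <= x <= 2 * pi -> derive1 f x = g x.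
Proof.
move=> pf fA cg g2.
have d0 : derive1 f 0 = g 0.
  apply/cvg_lim => //; apply: (@cvg_at_right_left_dnbhs _ R^o).
    exact: ac_slope_right twopi_gt0 fA cg.
  have := ac_slope_left twopi_gt0 fA cg; rewrite g2.
  by under eq_fun do rewrite -[X in f X - _]addr0 -addrA [_ + 0]addrC -[X in _ - f X]add0r addrA !pf.
move=> x /andP[]; rewrite le_eqVlt => /predU1P[<- _|x0]; first exact: d0.
rewrite le_eqVlt => /predU1P[->|x2].
  by rewrite g2 -d0 -[2 * pi]add0r periodic_derive1.
by rewrite derive1E; have [_ ->] := AC_derive fA cg x0 x2.
Qed.

Lemma W22_ac f : W22 f -> exists f2, [/\ integ 0 (2 * pi) (fun x => f2 x ^+ 2),
  ac 0 (2 * pi) f (derive1 f), ac 0 (2 * pi) (derive1 f) f2 &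
  derive1 f (2 * pi) = derive1 f 0].
Proof.
move=> [pf cf [f1 [f2 [_ _ f2L w1 w2]]]].
have [_ f2i hw2] := w2; have [_ _ hw1] := w1.
have cf' : wcont 0 (2 * pi) f by exact: wcontT.
have [|phi tp|F [fA FA F2]] := weak_second_derivative_ac (f := f) (g := f2) cf'.
- exact: L1_circle_integ.
- rewrite -[LHS]circle_int_itg hw1; last exact: test_function_derive1.
  by rewrite hw2// opprK.
have FE := periodic_ac_derive1 pf fA (AC_wcont FA) F2.
exists f2; split.
- exact: L2_circle_integ_sqr.
- by apply: eq_AC fA => // x /FE.
- by apply: eq_AC FA => // x /FE.
- by rewrite -[2 * pi]add0r periodic_derive1.
Qed.

(** By Lebesgue differentiation [g] is almost everywhere the derivative of its primitive, which
    vanishes. The two ends are discarded as null sets, to have a full neighbourhood inside the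
    segment. *)
Lemma itg_eq0_ae a b g : a <= b -> integ a b g -> (forall x, a <= x <= b -> itg a x g = 0) ->
  {ae mu, forall x, a <= x <= b -> g x = 0}.
Proof.
move=> ab gi g0; pose G := g \_ `[a, b].
have Gi : mu.-integrable setT (EFin \o G) by exact: integ_patch.
have Gy (y : R) : mu.-integrable `[a, y] (EFin \o G) by exact: integrableS Gi.
have Gl : locally_integrable setT G by exact: integrable_locally_restrict gi.
have H0 := @FTC1 R G (BLeft a) Gy Gl.
have ae_neq (c : R) : {ae mu, forall x, x != c}.
  exists [set c]; split => //; first exact: lebesgue_measure_set1.
  by move=> x /= /negP; rewrite negbK => /eqP.
have aeF := ae_filter_ringOfSetsType mu.
have := @filterI _ _ aeF _ _ H0 (@filterI _ _ aeF _ _ (ae_neq a) (ae_neq b)).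
apply: (@filterS _ _ aeF).
move=> x [Hx [xa xb]] /andP[ax xb'].
have {}ax : a < x by rewrite lt_neqAle eq_sym xa.
have {}xb : x < b by rewrite lt_neqAle xb.
have [//|_ xG] := Hx.
have -> : g x = G x by rewrite /G patchE mem_set//= in_itv/= !ltW.
rewrite -xG derive1E.
rewrite (@near_eq_derive _ _ _ _ (fun=> 0)) ?derive_cst//.
near=> y; have /andP[ay yb] : a < y < b by near: y; exact: near_itvoo.
rewrite -(g0 y) ?(ltW ay) ?(ltW yb)//; apply: eq_itg => z /andP[az zy].
by rewrite /G patchE mem_set//= in_itv/= az (le_trans zy (ltW yb)).
Unshelve. all: by end_near. Qed.

End WeakDerivatives.

(** * The Wirtinger inequality with a weight *)

Section Wirtinger.
Context {R : realType}.
Implicit Types (a b c p x y t : R) (f g d v S : R -> R).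

Lemma itg_gt0 a b f : a < b -> wcont a b f -> (forall x, a <= x <= b -> 0 < f x) ->
  0 < itg a b f.
Proof.
move=> ab cf f0.
have f_neq0 x : a <= x <= b -> f x != 0 by move=> /f0/gt_eqF ->.
have [M M0 hM] := wcont_bounded (wcontV cf f_neq0).
have M1 : 0 < (M + 1)^-1 by rewrite invr_gt0 ltr_wpDl.
have : (M + 1)^-1 * (b - a) <= itg a b f.
  rewrite -itg_cst ?(ltW ab)//; apply: le_itg.
  - exact/integ_cont/wcont_cst.
  - exact: integ_cont.
  - move=> x xab; have fx := f0 x xab.
    rewrite -[leRHS]invrK lef_pV2 ?posrE ?invr_gt0 ?ltr_wpDl//.
    apply: (le_trans (ler_norm _)); apply: (le_trans (hM x xab)).
    by rewrite lerDl.
by apply: lt_le_trans; rewrite mulr_gt0// subr_gt0.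
Qed.

Lemma wcont_comp_within a b c p f g : wcont a b f ->
  (forall x, a <= x <= b -> c <= f x <= p) -> wcont c p g -> wcont a b (fun x => g (f x)).
Proof.
move=> cf fcp cg; apply/subspace_continuousP => x xab.
have fx : `[c, p]%classic (f x) by move: xab; rewrite /= !in_itv/=; exact: fcp.
move/subspace_continuousP : cg => /(_ _ fx); apply: cvg_comp.
move/subspace_continuousP : cf => /(_ _ xab) cf U UU.
have := cf _ UU; rewrite /nbhs /= /within /=; apply: filterS => y h yab.
by apply: h => //; move: yab; rewrite !in_itv/=; exact: fcp.
Qed.

(* Expand [(d + k g tan th v) ^+ 2 / v >= 0] and integrate: the cross terms
   are the derivative of [k g ^+ 2 tan th] since [th' = k v]. *)
Lemma weighted_wirtinger_piece a b g d v S (k th0 : R) : a <= b ->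
  ac a b g d -> wcont a b d -> ac a b S v -> wcont a b v ->
  (forall x, a <= x <= b -> 0 < v x) ->
  (forall x, a <= x <= b -> - (pi / 2) < k * S x + th0 < pi / 2) ->
  k ^+ 2 * itg a b (fun x => g x ^+ 2 * v x) <=
  itg a b (fun x => d x ^+ 2 / v x) +
  k * (g b ^+ 2 * tan (k * S b + th0) - g a ^+ 2 * tan (k * S a + th0)).
Proof.
move=> ab gA cd SA cv v0 th.
pose theta x := k * S x + th0.
have cos_gt0 x : a <= x <= b -> 0 < cos (theta x) by move=> /th; exact: cos_gt0_pihalf.
have cos0 x : a <= x <= b -> cos (theta x) != 0 by move=> /cos_gt0/gt_eqF ->.
have ctheta : wcont a b theta.
  by apply: wcontD; [apply: wcontM; [exact: wcont_cst|exact: AC_wcont SA]|exact: wcont_cst].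
have ccos : wcont a b (fun x => cos (theta x)).
  by apply: (wcont_comp ctheta); exact: continuous_cos.
have ctan : wcont a b (fun x => tan (theta x)).
  apply: wcontM; last exact: wcontV.
  by apply: (wcont_comp ctheta); exact: continuous_sin.
have cg := AC_wcont gA.
pose dtan x := (1 + tan (theta x) ^+ 2) * (k * v x).
have cdtan : wcont a b dtan.
  apply: wcontM; last by apply: wcontM => //; exact: wcont_cst.
  by apply: wcontD; [exact: wcont_cst|exact: wcontX].
have tanA : ac a b (fun x => tan (theta x)) dtan.
  apply: AC_smooth => // x ax xb.
  have xab : a <= x <= b by rewrite !ltW.
  have dS := AC_derive SA cv ax xb.
  have dth : is_derive x 1 theta (k * v x).
    have := is_deriveD (is_deriveZ k dS) (is_derive_cst th0 x 1).
    by rewrite addr0.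
  have := is_derive1_comp (is_derive_tan (cos0 _ xab)) dth.
  by rewrite cos2_tan2// cos0.
have D := ACM (ACM gA gA) tanA.
have := AC_itg D (lexx a) ab (lexx b).
set Dg := (fun x => _); move=> hD.
have cv' : wcont a b (fun x => (v x)^-1) by apply: wcontV => // x /v0/gt_eqF ->.
have cDg : wcont a b Dg.
  apply: wcontD; apply: wcontM => //; last exact: wcontM.
  by apply: wcontD; exact: wcontM.
have i1 : integ a b (fun x => d x ^+ 2 / v x).
  by apply: integ_cont; apply: wcontM => //; exact: wcontX.
have i2 : integ a b (fun x => g x ^+ 2 * v x).
  by apply: integ_cont; apply: wcontM => //; exact: wcontX.
have i3 := integ_cont cDg.
have : 0 <= itg a b (fun x => d x ^+ 2 / v x + k * Dg x - k ^+ 2 * (g x ^+ 2 * v x)).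
  apply: itg_ge0 => x xab; have vx := v0 x xab.
  have -> : d x ^+ 2 / v x + k * Dg x - k ^+ 2 * (g x ^+ 2 * v x) =
      (d x + k * g x * tan (theta x) * v x) ^+ 2 / v x.
    by rewrite /Dg /dtan; field; rewrite gt_eqF.
  by rewrite divr_ge0 ?sqr_ge0// ltW.
rewrite itgB; [|by apply: integD => //; exact: integZ|exact: integZ].
rewrite itgD//; last exact: integZ.
rewrite !itgZ//.
have -> : itg a b Dg = g b * g b * tan (theta b) - g a * g a * tan (theta a).
  by rewrite hD addrC addKr.
rewrite /theta !expr2; lra.
Qed.

(* Two points [x0 <= x1] halving the weight with [g x0 = g x1]: apply the
   intermediate value theorem to [s |-> g (tau s) - g (tau (s + l / 2))], where
   [tau] is the inverse of [S] and [l = S p]. *)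
Lemma halving_chord p g v S : 0 < p -> wcont 0 p g -> wcont 0 p v ->
  (forall x, 0 <= x <= p -> 0 < v x) -> ac 0 p S v -> S 0 = 0 -> g p = g 0 ->
  exists x0 x1, [/\ 0 <= x0, x0 <= x1, x1 <= p, S x0 + S p / 2 = S x1 & g x0 = g x1].
Proof.
move=> p0 cg cv v0 SA S0 gp.
have Smono x y : 0 <= x -> x < y -> y <= p -> S x < S y.
  move=> x0 xy yp; rewrite (AC_itg SA x0 (ltW xy) yp) ltrDl.
  apply: itg_gt0 => //; first exact: (wcontS x0 yp cv).
  by move=> z /andP[xz zy]; apply: v0; rewrite (le_trans x0 xz) (le_trans zy yp).
have Sp : 0 < S p by rewrite -S0; exact: Smono.
have cS := AC_wcont SA.
have Ssurj s : 0 <= s <= S p -> exists x, 0 <= x <= p /\ S x = s.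
  move=> /andP[s0 sp]; have [|x] := IVT (v := s) (ltW p0) cS.
    by rewrite S0 ge_min le_max s0 sp orbT.
  by rewrite in_itv/= => xp Sx; exists x.
pose tau s := xget 0 [set x | 0 <= x <= p /\ S x = s].
have tauP s : 0 <= s <= S p -> 0 <= tau s <= p /\ S (tau s) = s.
  by move=> /Ssurj hs; exact: (xgetPex 0 hs).
have Sinj x y : 0 <= x <= p -> 0 <= y <= p -> S x = S y -> x = y.
  move=> /andP[x0 xp] /andP[y0 yp] Sxy.
  have [xy|yx|//] := ltgtP x y.
    by have := Smono _ _ x0 xy yp; rewrite Sxy ltxx.
  by have := Smono _ _ y0 yx xp; rewrite Sxy ltxx.
have Sitv x : 0 <= x <= p -> 0 <= S x <= S p.
  move=> /andP[]; rewrite le_eqVlt => /predU1P[<- _|x0].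
    by rewrite S0 lexx ltW.
  rewrite le_eqVlt => /predU1P[->|xp]; first by rewrite lexx ltW.
  by rewrite -[X in X <= _]S0 !ltW// Smono// ltW.
have tauS x : 0 <= x <= p -> tau (S x) = x.
  by move=> xp; have [h1 h2] := tauP _ (Sitv x xp); exact: Sinj.
have tau0 : tau 0 = 0 by rewrite -[X in tau X]S0 tauS// lexx ltW.
have tau_p : tau (S p) = p by rewrite tauS// lexx ltW.
have tau_mono s t : 0 <= s -> s < t -> t <= S p -> tau s < tau t.
  move=> s0 st tp; have [|/andP[a1 a2] e1] := tauP s; first by rewrite s0 (le_trans (ltW st) tp).
  have [|/andP[b1 b2] e2] := tauP t; first by rewrite tp (le_trans s0 (ltW st)).
  rewrite ltNge le_eqVlt; apply/negP => /predU1P[h|h].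
    by move: st; rewrite -e1 -e2 h ltxx.
  by have := Smono _ _ b1 h a2; rewrite e1 e2 ltNge (ltW st).
have ctau : wcont 0 (S p) tau.
  apply: segment_inc_surj_continuous.
    apply: le_mono_in => s t; rewrite !in_itv/= => /andP[s0 sp] /andP[t0 tp] st.
    exact: tau_mono.
  rewrite tau0 tau_p => x /=; rewrite in_itv/= => xp.
  by exists (S x); [rewrite /= in_itv/= Sitv|rewrite tauS].
pose D s := g (tau s) - g (tau (s + S p / 2)).
have h2 : 0 <= S p / 2 by rewrite divr_ge0 ?ltW.
have hp : S p / 2 <= S p by lra.
have cgt : wcont 0 (S p) (fun s => g (tau s)).
  by apply: (wcont_comp_within ctau _ cg) => s /tauP[].
have cD : wcont 0 (S p / 2) D.
  apply: wcontB; first exact: (wcontS (lexx 0) hp cgt).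
  have ca : wcont 0 (S p / 2) (fun s => s + S p / 2).
    by apply: wcontD; [exact: wcont_id|exact: wcont_cst].
  apply: (wcont_comp_within ca _ cgt) => s /andP[s0 sp]; lra.
(* The end values of [D] are opposite, because [g p = g 0]. *)
have [|s] := IVT (v := 0) h2 cD.
  rewrite /D add0r -splitr tau0 tau_p gp.
  set A := g 0; set B := g _.
  rewrite ge_min le_max; have [AB|AB] := leP A B;
    apply/andP; split; apply/orP; [left|right|right|left]; lra.
rewrite in_itv/= => /andP[s0 sp] /eqP; rewrite subr_eq0 => /eqP Ds.
have [|/andP[a1 a2] e1] := tauP s; first by rewrite s0 (le_trans sp hp).
have [|/andP[b1 b2] e2] := tauP (s + S p / 2); first lra.
exists (tau s), (tau (s + S p / 2)); split => //; last by rewrite e1 e2.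
rewrite le_eqVlt; apply/orP; right; apply: tau_mono => //; last lra.
by rewrite ltrDl divr_gt0.
Qed.

(** The constant [c] is the common value at the ends of a halving chord, rather than the mean, so no
    Fourier series is needed: [g - c] vanishes at both ends of two arcs of weight [l / 2], and each
    arc gets a phase centred at its midpoint. *)
Lemma weighted_wirtinger p g d v : 0 < p -> ac 0 p g d -> wcont 0 p d -> wcont 0 p v ->
  (forall x, 0 <= x <= p -> 0 < v x) -> g p = g 0 ->
  exists c, itg 0 p (fun x => (g x - c) ^+ 2 * v x) <=
    (itg 0 p v / (2 * pi)) ^+ 2 * itg 0 p (fun x => d x ^+ 2 / v x).
Proof.
move=> p0 gA cd cv v0 gp.
pose S x := itg 0 x v.
have SA : ac 0 p S v by apply: AC_itgP; exact: integ_cont.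
have S0 : S 0 = 0 by rewrite /S itg_pt.
have [x0 [x1 [x0_ge0 x01 x1p Sx gx]]] := halving_chord p0 (AC_wcont gA) cv v0 SA S0 gp.
exists (g x0); pose h x := g x - g x0.
have hA : ac 0 p h d.
  apply: eq_AC (ACB gA (AC_cst _ _ (g x0))) => // x _; exact: subr0.
have pi0 := @pi_gt0 R.
have Sle x y : 0 <= x -> x <= y -> y <= p -> S x <= S y.
  move=> x_0 xy yp; rewrite (AC_itg SA x_0 xy yp) lerDl; apply: itg_ge0 => z /andP[xz zy].
  by apply/ltW/v0; rewrite (le_trans x_0 xz) (le_trans zy yp).
have Sp : 0 < S p.
  by rewrite (AC_itg SA (lexx 0) (ltW p0) (lexx p)) S0 add0r; apply: itg_gt0.
set l := S p in Sp Sx *; set Y := itg 0 p (fun x => d x ^+ 2 / v x).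
set X := itg 0 p (fun x => h x ^+ 2 * v x).
have ch := AC_wcont hA.
have iX : integ 0 p (fun x => h x ^+ 2 * v x).
  by apply: integ_cont; apply: wcontM => //; exact: wcontX.
have iY : integ 0 p (fun x => d x ^+ 2 / v x).
  apply: integ_cont; apply: wcontM; first exact: wcontX.
  by apply: wcontV => // x /v0/gt_eqF ->.
have X0 : 0 <= X.
  by apply: itg_ge0 => x /v0 vx; rewrite mulr_ge0 ?sqr_ge0// ltW.
(* At [t = 1] the phases would reach [pi / 2], where the tangent blows up; the sharp constant is
   recovered at the end by letting [t] tend to [1]. *)
have key t : 0 < t -> t < 1 -> (t * (2 * pi / l)) ^+ 2 * X <= Y.
  move=> t0 t1; set k := t * (2 * pi / l).
  have k0 : 0 < k by rewrite mulr_gt0// divr_gt0// mulr_gt0.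
  have kl : k * (l / 4) = t * (pi / 2) by rewrite /k; field; rewrite gt_eqF.
  have small u : - (l / 4) <= u <= l / 4 -> - (pi / 2) < k * u < pi / 2.
    move=> /andP[u1 u2].
    have tp : t * (pi / 2) < pi / 2 by rewrite gtr_pMl// divr_gt0.
    have w1 : k * u <= k * (l / 4) by rewrite ler_pM2l.
    have w2 : k * - (l / 4) <= k * u by rewrite ler_pM2l.
    move: w1 w2; rewrite mulrN kl => w1 w2; lra.
  have piece a b th : 0 <= a -> a <= b -> b <= p ->
      (forall x, a <= x <= b -> - (pi / 2) < k * S x + th < pi / 2) ->
      k ^+ 2 * itg a b (fun x => h x ^+ 2 * v x) <=
      itg a b (fun x => d x ^+ 2 / v x) +
      k * (h b ^+ 2 * tan (k * S b + th) - h a ^+ 2 * tan (k * S a + th)).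
    move=> a0 ab bp hth; apply: weighted_wirtinger_piece => //.
    - exact: (ACS a0 bp hA).
    - exact: (wcontS a0 bp cd).
    - exact: (ACS a0 bp SA).
    - exact: (wcontS a0 bp cv).
    - by move=> x /andP[ax xb]; apply: v0; rewrite (le_trans a0 ax) (le_trans xb bp).
  have h0 : h x0 = 0 by rewrite /h subrr.
  have h1 : h x1 = 0 by rewrite /h gx subrr.
  have hp : h p = h 0 by rewrite /h gp.
  have S00 : S 0 = 0 by [].
  have x0p := le_trans x01 x1p.
  have x1_ge0 := le_trans x0_ge0 x01.
  have SxP : S x1 <= l := Sle _ _ x1_ge0 x1p (lexx p).
  have Sx0 : 0 <= S x0 by rewrite -S00; exact: Sle.
  have thP1 x : 0 <= x <= x0 -> - (pi / 2) < k * S x + (- (k * (S x0 - l / 4))) < pi / 2.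
    move=> /andP[xa xb]; rewrite -mulrBr; apply: small.
    have := Sle _ _ xa xb x0p; have := Sle _ _ (lexx 0) xa (le_trans xb x0p).
    rewrite S00; lra.
  have P1 := @piece 0 x0 (- (k * (S x0 - l / 4))) (lexx 0) x0_ge0 x0p thP1.
  have thP2 x : x0 <= x <= x1 -> - (pi / 2) < k * S x + (- (k * (S x0 + l / 4))) < pi / 2.
    move=> /andP[xa xb]; rewrite -mulrBr; apply: small.
    have := Sle _ _ (le_trans x0_ge0 xa) xb x1p; have := Sle _ _ x0_ge0 xa (le_trans xb x1p).
    lra.
  have P2 := @piece x0 x1 (- (k * (S x0 + l / 4))) x0_ge0 x01 x1p thP2.
  have thP3 x : x1 <= x <= p -> - (pi / 2) < k * S x + (- (k * (S x1 + l / 4))) < pi / 2.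
    move=> /andP[xa xb]; rewrite -mulrBr; apply: small.
    have := Sle _ _ (le_trans x1_ge0 xa) xb (lexx p); have := Sle _ _ x1_ge0 xa xb.
    rewrite -/l; lra.
  have P3 := @piece x1 p (- (k * (S x1 + l / 4))) x1_ge0 x1p (lexx p) thP3.
  (* The arc through the base point is cut into [[0, x0]] and [[x1, p]]. Their phases agree at [0]
     and [p], so the boundary terms there cancel. *)
  have E1 : k * S 0 + - (k * (S x0 - l / 4)) = k * S p + - (k * (S x1 + l / 4)).
    by rewrite -Sx S00 -/l; field.
  move: P1 P2 P3; rewrite h0 h1 hp E1 !expr0n/= !mul0r.
  rewrite /X /Y (@itg_chasles _ 0 p x0)// (@itg_chasles _ x0 p x1)//; last exact: (integS x0_ge0 _ iX).
  rewrite (@itg_chasles _ 0 p x0 (fun x => d x ^+ 2 / v x))//.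
  rewrite (@itg_chasles _ x0 p x1 (fun x => d x ^+ 2 / v x))//; last exact: (integS x0_ge0 _ iY).
  lra.
have tl0 : 0 < 2 * pi / l by rewrite divr_gt0// mulr_gt0.
suff : (2 * pi / l) ^+ 2 * X <= Y.
  rewrite -ler_pdivlMl ?exprn_gt0// => hX.
  by rewrite -[l / (2 * pi)]invf_div exprVn.
rewrite leNgt; apply/negP => YX.
pose W := (2 * pi / l) ^+ 2 * X.
have W0 : 0 <= Y by apply: itg_ge0 => x /v0 vx; rewrite divr_ge0 ?sqr_ge0// ltW.
have Wp : 0 < W by exact: le_lt_trans YX.
(* With this [e], [(1 - e) ^+ 2 * W] is at least [W - (W - Y) / 2], which is still larger than
   [Y]. *)
have [e [e0 e1 eW]] : exists e : R, [/\ 0 < e, e <= 1 / 4 & e * W = (W - Y) / 4].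
  exists ((W - Y) / (4 * W)); split.
  - by rewrite divr_gt0 ?subr_gt0// mulr_gt0.
  - have -> : (W - Y) / (4 * W) = (1 - Y / W) / 4 by field; rewrite gt_eqF.
    by rewrite ler_pM2r ?invr_gt0// gerBl divr_ge0// ltW.
  - by field; rewrite gt_eqF.
have t0 : 0 < 1 - e by lra.
have t1 : 1 - e < 1 by lra.
have hW : (1 - e) ^+ 2 * W <= Y by rewrite /W mulrA -exprMn; exact: key.
have eT : (1 - e) ^+ 2 * W = W - 2 * ((W - Y) / 4) + e * ((W - Y) / 4).
  by rewrite -eW; ring.
have e2 : 0 <= e * ((W - Y) / 4) by rewrite mulr_ge0 ?(ltW e0)// divr_ge0// subr_ge0 ltW.
have YW : Y < W by [].
move: hW e2 YW; rewrite eT; lra.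
Qed.

End Wirtinger.

(** * The inequality in the moving frame *)

Section FrameInequality.
Context {R : realType}.
Implicit Types (a b c p x y m : R) (f g h v : R -> R).

(* Cauchy-Schwarz, as the discriminant of [t |-> \int (t f - g) ^+ 2 v]. *)
Lemma itg_cauchy_schwarz a b f g v : (forall x, a <= x <= b -> 0 <= v x) ->
  integ a b (fun x => f x ^+ 2 * v x) -> integ a b (fun x => f x * g x * v x) ->
  integ a b (fun x => g x ^+ 2 * v x) ->
  itg a b (fun x => f x * g x * v x) ^+ 2 <=
  itg a b (fun x => f x ^+ 2 * v x) * itg a b (fun x => g x ^+ 2 * v x).
Proof.
move=> v0 ff fg gg.
set F := itg _ _ _; set C := itg _ _ _; set G := itg _ _ _.
have quad s t : 0 <= s ^+ 2 * C - 2 * s * t * F + t ^+ 2 * G.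
  have -> : s ^+ 2 * C - 2 * s * t * F + t ^+ 2 * G =
      itg a b (fun x => s ^+ 2 * (f x ^+ 2 * v x) - (2 * s * t) * (f x * g x * v x)
        + t ^+ 2 * (g x ^+ 2 * v x)).
    rewrite itgD; [|by apply: integB; exact: integZ|exact: integZ].
    by rewrite itgB ?itgZ//; exact: integZ.
  apply: itg_ge0 => x xab.
  have -> : s ^+ 2 * (f x ^+ 2 * v x) - (2 * s * t) * (f x * g x * v x)
      + t ^+ 2 * (g x ^+ 2 * v x) = (s * f x - t * g x) ^+ 2 * v x by ring.
  by rewrite mulr_ge0 ?sqr_ge0// v0.
have C0 : 0 <= C by apply: itg_ge0 => x xab; rewrite mulr_ge0 ?sqr_ge0// v0.
have G0 : 0 <= G by apply: itg_ge0 => x xab; rewrite mulr_ge0 ?sqr_ge0// v0.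
(* The form [quad] is homogeneous, so the discriminant is read off without division, at [(F, C)];
   the degenerate cases use [(G, F)] and [(1, F)]. *)
move: C0; rewrite le_eqVlt => /predU1P[C0|C0].
  move: G0; rewrite le_eqVlt => /predU1P[G0|G0].
    have := quad 1 F; rewrite -C0 -G0 => h; nra.
  have := quad G F; rewrite -C0 => h.
  have : 0 <= - (F ^+ 2 * G) by move: h; lra.
  by rewrite oppr_ge0 pmulr_lle0// mul0r.
have := quad F C => h.
have : 0 <= C * (C * G - F ^+ 2) by move: h; lra.
by rewrite pmulr_rge0// subr_ge0.
Qed.

(** Two points cut the circle into two arcs over which [f] changes by the same amount up to sign, so
    twice that change is at most the total variation. Taking [m] midway between the extrema halves
    the bound again. *)
Lemma periodic_oscillation p f g : 0 <= p -> ac 0 p f g -> f p = f 0 ->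
  exists m, forall x, 0 <= x <= p -> `|f x - m| <= itg 0 p (fun x => `|g x|) / 4.
Proof.
move=> p0 fA fp; have gi := AC_integ fA; have ni := integ_norm gi.
set C := itg _ _ _.
have osc x y : 0 <= x -> x <= y -> y <= p -> `|f y - f x| <= C / 2.
  move=> x0 xy yp; have xp := le_trans xy yp; have y0 := le_trans x0 xy.
  have C_split : C = itg 0 x (fun x => `|g x|) + itg x y (fun x => `|g x|)
      + itg y p (fun x => `|g x|).
    rewrite /C (@itg_chasles _ 0 p x)// (@itg_chasles _ x p y) ?addrA//.
    exact: (integS x0 _ ni).
  have h1 := normr_itg (integS (lexx 0) xp gi).
  have h2 := normr_itg (integS x0 yp gi).
  have h3 := normr_itg (integS y0 (lexx p) gi).
  have e1 := AC_itg fA (lexx 0) x0 xp.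
  have e2 := AC_itg fA x0 xy yp.
  have e3 := AC_itg fA y0 yp (lexx p).
  move: h1 h2 h3; rewrite C_split.
  set i1 := itg 0 x g in e1 *; set i2 := itg x y g in e2 *; set i3 := itg y p g in e3 *.
  rewrite !ler_norml => /andP[? ?] /andP[? ?] /andP[? ?]; lra.
have cf := AC_wcont fA.
have [M] := EVT_max p0 cf; rewrite in_itv/= => /andP[M0 Mp] hM.
have [m] := EVT_min p0 cf; rewrite in_itv/= => /andP[m0 mp] hm.
have Mm : f M - f m <= C / 2.
  have [Mm|mM] := leP M m.
    by have := osc _ _ M0 Mm mp; rewrite ler_norml => /andP[? ?]; lra.
  by have := osc _ _ m0 (ltW mM) Mp; rewrite ler_norml => /andP[? ?]; lra.
exists ((f M + f m) / 2) => x xp.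
have := hM x; have := hm x; rewrite in_itv/= xp => /(_ isT) ? /(_ isT) ?.
rewrite ler_norml; lra.
Qed.

(* In the moving frame [(t, n)] along the curve [x]: [u = t.x], [q = n.x], so
   that [q' = - v k u] and [u' = v + v k q]. *)
Lemma frame_inequality (x1 x2 d1 d2 t1 t2 w1 w2 v k : R -> R) (p : R) : 0 < p ->
  ac 0 p x1 d1 -> ac 0 p x2 d2 -> ac 0 p t1 w1 -> ac 0 p t2 w2 ->
  x1 p = x1 0 -> x2 p = x2 0 -> t1 p = t1 0 -> t2 p = t2 0 ->
  wcont 0 p v -> (forall x, 0 <= x <= p -> 0 < v x) ->
  (forall x, 0 <= x <= p -> d1 x = v x * t1 x) ->
  (forall x, 0 <= x <= p -> d2 x = v x * t2 x) ->
  (forall x, 0 <= x <= p -> t1 x ^+ 2 + t2 x ^+ 2 = 1) ->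
  (forall x, 0 <= x <= p -> w1 x = v x * (k x * - t2 x)) ->
  (forall x, 0 <= x <= p -> w2 x = v x * (k x * t1 x)) ->
  integ 0 p (fun x => k x ^+ 2 * v x) ->
  let l := itg 0 p v in
  let r := l / (2 * pi) in
  let A := - 2^-1 * itg 0 p (fun x => (t1 x * x2 x - t2 x * x1 x) * v x) in
  let E := itg 0 p (fun x => k x ^+ 2 * v x) in
  itg 0 p (fun x => (x1 x ^+ 2 + x2 x ^+ 2) * v x) <= r ^+ 2 * l ->
  l / r ^+ 2 <= E /\
  r ^+ 2 * l - 4 * A ^+ 2 / l <= r ^+ 4 * (E - l / r ^+ 2) * (1 + E * l / 16).
Proof.
move=> p0 x1A x2A t1A t2A x1p x2p t1p t2p cv v0 d1E d2E t12 w1E w2E Ei l r A E hM.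
have l0 : 0 < l by exact: itg_gt0.
have r0 : 0 < r by rewrite divr_gt0// mulr_gt0// pi_gt0.
have cx1 := AC_wcont x1A; have cx2 := AC_wcont x2A.
have ct1 := AC_wcont t1A; have ct2 := AC_wcont t2A.
pose u x := t1 x * x1 x + t2 x * x2 x.
pose q x := t1 x * x2 x - t2 x * x1 x.
have cu : wcont 0 p u by apply: wcontD; exact: wcontM.
have cq : wcont 0 p q by apply: wcontB; exact: wcontM.
(* Only [k ^+ 2 * v] is assumed integrable; [v * k] is recovered as the component of the tangent's
   derivative along the normal. *)
have kvi : integ 0 p (fun x => v x * k x).
  apply: (eq_integ (f := fun x => t1 x * w2 x - t2 x * w1 x)).
    move=> x xp; rewrite w1E// w2E//.
    by rewrite -[RHS]mulr1 -(t12 x xp); ring.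
  by apply: integB; apply: integMc => //; [exact: AC_integ t2A|exact: AC_integ t1A].
have qA : ac 0 p q (fun x => - (v x * k x * u x)).
  apply: eq_AC (ACB (ACM t1A x2A) (ACM t2A x1A)) => // x xp.
  by rewrite w1E// w2E// d1E// d2E// /u; ring.
have uA : ac 0 p u (fun x => v x + v x * k x * q x).
  apply: eq_AC (ACD (ACM t1A x1A) (ACM t2A x2A)) => // x xp.
  rewrite w1E// w2E// d1E// d2E// /q -[X in _ = X + _]mulr1 -(t12 x xp); ring.
have kq_i : integ 0 p (fun x => k x * q x * v x).
  by apply: eq_integ (integMc cq kvi) => x _; ring.
have ku_i : integ 0 p (fun x => k x * u x * v x).
  by apply: eq_integ (integMc cu kvi) => x _; ring.
have q2_i : integ 0 p (fun x => q x ^+ 2 * v x).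
  by apply: integ_cont; apply: wcontM => //; exact: wcontX.
have u2_i : integ 0 p (fun x => u x ^+ 2 * v x).
  by apply: integ_cont; apply: wcontM => //; exact: wcontX.
have q_i : integ 0 p (fun x => q x * v x) by apply: integ_cont; exact: wcontM.
have v_i := integ_cont cv.
set Q2 := itg 0 p (fun x => q x ^+ 2 * v x).
set U := itg 0 p (fun x => u x ^+ 2 * v x).
set M := itg 0 p _ in hM.
have MQU : M = Q2 + U.
  rewrite -itgD//; apply: eq_itg => x xp.
  rewrite -[LHS]mulr1 -(t12 x xp) /q /u; ring.
have up : u p = u 0 by rewrite /u t1p t2p x1p x2p.
have qp : q p = q 0 by rewrite /q t1p t2p x1p x2p.
have kq : itg 0 p (fun x => k x * q x * v x) = - l.
  have := AC_itg uA (lexx 0) (ltW p0) (lexx p).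
  rewrite up -[X in X = _ -> _]addr0 => /addrI/esym.
  rewrite (eq_itg (g := fun x => v x + k x * q x * v x)) => [|x _]; last by ring.
  by rewrite itgD// => /eqP; rewrite addrC addr_eq0 => /eqP.
have E_lower : l / r ^+ 2 + (r ^+ 2 * l - Q2) / r ^+ 4 <= E.
  have : 0 <= itg 0 p (fun x => k x ^+ 2 * v x + (2 / r ^+ 2) * (k x * q x * v x)
      + (1 / r ^+ 4) * (q x ^+ 2 * v x)).
    apply: itg_ge0 => x xp.
    have -> : k x ^+ 2 * v x + (2 / r ^+ 2) * (k x * q x * v x)
        + (1 / r ^+ 4) * (q x ^+ 2 * v x) = (k x + q x / r ^+ 2) ^+ 2 * v x.
      by field; rewrite gt_eqF.
    by rewrite mulr_ge0 ?sqr_ge0// ltW// v0.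
  rewrite itgD; [|by apply: integD => //; exact: integZ|exact: integZ].
  rewrite itgD//; last exact: integZ.
  rewrite !itgZ// kq -/E -/Q2.
  have -> : (r ^+ 2 * l - Q2) / r ^+ 4 = l / r ^+ 2 - (1 / r ^+ 4) * Q2.
    by field; rewrite gt_eqF.
  have -> : 2 / r ^+ 2 * - l = - 2 * (l / r ^+ 2) by ring.
  lra.
have [m hm] := periodic_oscillation (ltW p0) qA qp.
set C := itg 0 p _ in hm.
have CE : C = itg 0 p (fun x => `|k x| * `|u x| * v x).
  apply: eq_itg => x xp; rewrite normrN !normrM (gtr0_norm (v0 x xp)); ring.
have C0 : 0 <= C by apply: itg_ge0 => x _; exact: normr_ge0.
have CS : C ^+ 2 <= E * U.
  have eE : E = itg 0 p (fun x => `|k x| ^+ 2 * v x).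
    by apply: eq_itg => x _; rewrite real_normK ?num_real.
  have eU : U = itg 0 p (fun x => `|u x| ^+ 2 * v x).
    by apply: eq_itg => x _; rewrite real_normK ?num_real.
  rewrite CE eE eU; apply: itg_cauchy_schwarz.
  - by move=> x /v0/ltW.
  - by apply: eq_integ Ei => x _; rewrite real_normK ?num_real.
  - apply: eq_integ (integ_norm ku_i) => x xp.
    by rewrite !normrM (gtr0_norm (v0 x xp)).
  - by apply: eq_integ u2_i => x _; rewrite real_normK ?num_real.
set B := itg 0 p (fun x => q x * v x).
have AE : A = - 2^-1 * B by [].
have qm : Q2 - 2 * m * B + m ^+ 2 * l <= (C / 4) ^+ 2 * l.
  have -> : Q2 - 2 * m * B + m ^+ 2 * l = itg 0 p (fun x => (q x - m) ^+ 2 * v x).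
    rewrite (eq_itg (f := fun x => (q x - m) ^+ 2 * v x) (g := fun x =>
      (q x ^+ 2 * v x - (2 * m) * (q x * v x)) + m ^+ 2 * v x)); last by move=> x _; ring.
    rewrite itgD; [|by apply: integB => //; exact: integZ|exact: integZ].
    by rewrite itgB ?itgZ//; exact: integZ.
  rewrite -itgZ//; apply: le_itg.
  - by apply: integ_cont; apply: wcontM => //; apply: wcontX; apply: wcontB => //; exact: wcont_cst.
  - exact: integZ.
  move=> x xp; rewrite ler_wpM2r ?(ltW (v0 x xp))//.
  rewrite -[(q x - m) ^+ 2]real_normK ?num_real// lerXn2r ?nnegrE ?divr_ge0//.
  exact: hm.
(* The mean [B / l] minimises the quadratic deviation, so the midrange [m] may be replaced by it. *)
have Q2_upper : Q2 - B ^+ 2 / l <= E * U * l / 16.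
  have h1 : 0 <= (m - B / l) ^+ 2 * l by rewrite mulr_ge0 ?sqr_ge0// ltW.
  have h2 : (m - B / l) ^+ 2 * l = m ^+ 2 * l - 2 * m * B + B ^+ 2 / l.
    by field; rewrite gt_eqF.
  have h3 : C ^+ 2 * l <= E * U * l by rewrite ler_pM2r.
  have h4 : (C / 4) ^+ 2 * l = C ^+ 2 * l / 16 by field.
  move: h1 qm; rewrite h2 h4; lra.
have U0 : 0 <= U by apply: itg_ge0 => x /v0 vx; rewrite mulr_ge0 ?sqr_ge0// ltW.
have E0 : 0 <= E by apply: itg_ge0 => x /v0 vx; rewrite mulr_ge0 ?sqr_ge0// ltW.
have W0 : 0 <= r ^+ 2 * l - M by rewrite subr_ge0.
have S0 : r ^+ 2 * l - Q2 = (r ^+ 2 * l - M) + U by rewrite MQU; ring.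
have S_le : r ^+ 2 * l - Q2 <= r ^+ 4 * (E - l / r ^+ 2).
  rewrite -ler_pdivrMl ?exprn_gt0// mulrC; lra.
split.
  apply: le_trans E_lower; rewrite lerDl; apply: divr_ge0.
    by rewrite S0; exact: addr_ge0.
  by rewrite exprn_ge0// ltW.
(* The defect splits into [r ^+ 2 * l - Q2] and the variance term [Q2 - B ^+ 2 / l]. The latter is
   at most [E * U * l / 16], and [U <= r ^+ 2 * l - Q2] by the Wirtinger hypothesis, whence the
   common factor. *)
apply: (@le_trans _ _ ((r ^+ 2 * l - Q2) * (1 + E * l / 16))); last first.
  by rewrite ler_wpM2r// addr_ge0// divr_ge0// mulr_ge0// ltW.
have -> : 4 * A ^+ 2 / l = B ^+ 2 / l by rewrite AE; field; rewrite gt_eqF.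
have : E * U * l <= E * (r ^+ 2 * l - Q2) * l.
  by rewrite ler_pM2r// ler_wpM2l// S0 lerDr.
move: Q2_upper; lra.
Qed.

End FrameInequality.

(** * Almost everywhere equality and square integrability of the curvature *)

Section AlmostEverywhere.
Context {R : realType}.
Implicit Types (a b p x : R) (f g : R -> R).
Notation mu := (@lebesgue_measure R).

Lemma itg_ae a b f g : measurable_fun `[a, b] f -> measurable_fun `[a, b] g ->
  {ae mu, forall x, a <= x <= b -> f x = g x} -> itg a b f = itg a b g.
Proof.
move=> mf mg fg; rewrite /itg /Rintegral; congr fine; apply: ae_eq_integral => //.
- exact/measurable_EFinP.
- exact/measurable_EFinP.
have aeF := ae_filter_ringOfSetsType mu.
move: fg; apply: (@filterS _ _ aeF) => x h xab.
by rewrite h//; move: xab; rewrite /= in_itv.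
Qed.

Lemma integ_ae a b f g : measurable_fun `[a, b] g -> integ a b f ->
  {ae mu, forall x, a <= x <= b -> f x = g x} -> integ a b g.
Proof.
move=> mg fi fg; have mf := integ_measurable fi.
have /integrableP[_ foo] := fi.
apply/integrableP; split; first exact/measurable_EFinP.
rewrite (_ : (\int[mu]_(x in `[a, b]) `|(EFin \o g) x|)%E =
             (\int[mu]_(x in `[a, b]) `|(EFin \o f) x|)%E)//.
apply: ge0_ae_eq_integral => //.
- by apply/measurable_EFinP/measurableT_comp.
- by apply/measurable_EFinP/measurableT_comp.
have aeF := ae_filter_ringOfSetsType mu.
move: fg; apply: (@filterS _ _ aeF) => x h xab.
by rewrite /= h//; move: xab; rewrite /= in_itv.
Qed.

(* Differentiating [t1 d2 - t2 d1 = 0] gives [v ^+ 2 k = t1 a2 - t2 a1]. *)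
Lemma curvature_sq_integ (d1 d2 a1 a2 t1 t2 w1 w2 v k : R -> R) (p : R) : 0 <= p ->
  ac 0 p d1 a1 -> ac 0 p d2 a2 -> ac 0 p t1 w1 -> ac 0 p t2 w2 ->
  integ 0 p (fun x => a1 x ^+ 2) -> integ 0 p (fun x => a2 x ^+ 2) ->
  wcont 0 p v -> (forall x, 0 <= x <= p -> 0 < v x) ->
  (forall x, 0 <= x <= p -> d1 x = v x * t1 x) ->
  (forall x, 0 <= x <= p -> d2 x = v x * t2 x) ->
  (forall x, 0 <= x <= p -> t1 x ^+ 2 + t2 x ^+ 2 = 1) ->
  (forall x, 0 <= x <= p -> w1 x = v x * (k x * - t2 x)) ->
  (forall x, 0 <= x <= p -> w2 x = v x * (k x * t1 x)) ->
  measurable_fun `[0, p] k ->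
  integ 0 p (fun x => k x ^+ 2 * v x).
Proof.
move=> p0 d1A d2A t1A t2A a1i a2i cv v0 d1E d2E t12 w1E w2E mk.
have ct1 := AC_wcont t1A; have ct2 := AC_wcont t2A.
pose b x := t1 x * a2 x - t2 x * a1 x.
have bkA : ac 0 p (fun x => t1 x * d2 x - t2 x * d1 x) (fun x => b x - v x ^+ 2 * k x).
  apply: eq_AC (ACB (ACM t1A d2A) (ACM t2A d1A)) => // x xp.
  rewrite w1E// w2E// d1E// d2E// /b.
  by rewrite -[v x ^+ 2 * k x]mulr1 -(t12 x xp); ring.
have bk0 x : 0 <= x <= p -> itg 0 x (fun x => b x - v x ^+ 2 * k x) = 0.
  move=> /[dup] xp /andP[x0 xp']; have := AC_itg bkA (lexx 0) x0 xp'.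
  have z y : 0 <= y <= p -> t1 y * d2 y - t2 y * d1 y = 0.
    by move=> yp; rewrite d1E// d2E//; ring.
  by rewrite !z ?lexx// add0r => <-.
have bk := itg_eq0_ae p0 (AC_integ bkA) bk0.
have cv' : wcont 0 p (fun x => (v x)^-1) by apply: wcontV => // x /v0/gt_eqF ->.
have mv := wcont_measurable cv; have mv' := wcont_measurable cv'.
have mb : measurable_fun `[0, p] b.
  apply: measurable_funB; apply: measurable_funM.
  - exact: wcont_measurable.
  - exact: integ_measurable (AC_integ d2A).
  - exact: wcont_measurable.
  - exact: integ_measurable (AC_integ d1A).
have b2i : integ 0 p (fun x => b x ^+ 2).
  apply: (integ_le (g := fun x => a1 x ^+ 2 + a2 x ^+ 2)); [|exact: integD|].
    exact: measurable_funX.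
  move=> x xp; rewrite ger0_norm ?sqr_ge0//.
  (* Pythagoras in the moving frame: [b] is the normal component of the second derivative. *)
  have -> : a1 x ^+ 2 + a2 x ^+ 2 = b x ^+ 2 + (t1 x * a1 x + t2 x * a2 x) ^+ 2.
    by rewrite -[LHS]mulr1 -(t12 x xp) /b; ring.
  by rewrite lerDl sqr_ge0.
have fi : integ 0 p (fun x => (v x)^-1 ^+ 3 * b x ^+ 2).
  by apply: integMc => //; exact: wcontX.
apply: integ_ae fi _.
  by apply: measurable_funM => //; exact: measurable_funX.
have aeF := ae_filter_ringOfSetsType mu.
move: bk; apply: (@filterS _ _ aeF) => x h xp.
have /eqP := h xp; rewrite subr_eq0 => /eqP ->.
by field; rewrite gt_eqF ?v0.
Qed.

End AlmostEverywhere.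

(** * Numerical bounds *)

Section Numerics.
Context {R : realType}.
Implicit Types x : R.

Lemma sin_upper x : 0 <= x -> sin x <= x.
Proof.
move=> x0; have A := @AC_C1 R 0 x (@sin R) (@cos R) x0 (@continuous_cos R) (@is_derive_sin R).
rewrite (AC_itg A (lexx 0) x0 (lexx x)) sin0 add0r -[leRHS]subr0 -[leRHS]mul1r.
rewrite -itg_cst//; apply: le_itg => [||y _].
- by apply: integ_cont; apply: wcontT; exact: continuous_cos.
- exact/integ_cont/wcont_cst.
- exact: cos_le1.
Qed.

Lemma cos_lower x : 0 <= x -> 1 - x ^+ 2 / 2 <= cos x.
Proof.
move=> x0; have -> : cos x = 1 - 2 * sin (x / 2) ^+ 2.
  by rewrite {1}(splitr x) -mulr2n cos_mulr2n cos2sin2; ring.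
have s1 : `|sin (x / 2)| <= x / 2.
  have x2 : 0 <= x / 2 by rewrite divr_ge0.
  rewrite ler_norml sin_upper// andbT.
  have [h|h] := leP 1 (x / 2); first by apply: le_trans (sin_geN1 _); rewrite lerN2.
  apply: (@le_trans _ _ 0); first by rewrite oppr_le0.
  by apply: sin_ge0_pi; have := @pi_ge2 R; lra.
have : sin (x / 2) ^+ 2 <= (x / 2) ^+ 2.
  by rewrite -[leLHS]real_normK ?num_real// lerXn2r ?nnegrE// divr_ge0.
rewrite expr_div_n; lra.
Qed.

Lemma sin_lower x : 0 <= x -> x - x ^+ 3 / 6 <= sin x.
Proof.
move=> x0; have A := @AC_C1 R 0 x (@sin R) (@cos R) x0 (@continuous_cos R) (@is_derive_sin R).
pose P y : R := y - y ^+ 3 / 6; pose Q y : R := 1 - y ^+ 2 / 2.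
have cQ : wcont 0 x Q.
  apply: wcontB; first exact: wcont_cst.
  by apply: wcontM; [apply: wcontX; exact: wcont_id|exact: wcont_cst].
have B : ac 0 x P Q.
  apply: AC_smooth => //.
    apply: wcontB; first exact: wcont_id.
    by apply: wcontM; [apply: wcontX; exact: wcont_id|exact: wcont_cst].
  move=> y _ _; rewrite /P /Q; apply: is_derive_eq.
  by rewrite /GRing.scale/=; field.
rewrite (AC_itg A (lexx 0) x0 (lexx x)) sin0 add0r.
have := AC_itg B (lexx 0) x0 (lexx x).
rewrite /P expr0n/= mul0r subr0 add0r => ->.
apply: le_itg => [||y /andP[y0 _]].
- exact: integ_cont.
- by apply: integ_cont; apply: wcontT; exact: continuous_cos.
- exact: cos_lower.
Qed.

(** Otherwise [8 / 5] would not exceed [pi / 2] and its cosine would be nonnegative, yet the double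
    angle formula with [sin (4 / 5) >= 71 / 100] makes it negative. *)
Lemma pi_lt_16_5 : pi < 16 / 5 :> R.
Proof.
rewrite ltNge; apply/negP => pi_large.
have c0 : 0 <= cos (8 / 5 : R).
  by apply: cos_ge0_pihalf; have := @pi_gt0 R; lra.
have : cos (8 / 5 : R) = 1 - 2 * sin (4 / 5) ^+ 2.
  have -> : 8 / 5 = (4 / 5) *+ 2 :> R by rewrite mulr2n; field.
  by rewrite cos_mulr2n cos2sin2; ring.
have : 71 / 100 <= sin (4 / 5 : R).
  by apply: le_trans (sin_lower _); [lra|lra].
move: c0; set s := sin _; set c := cos _ => c0 s0 cE; nra.
Qed.

(** Contradiction with [E < 2 * p + e / 20]: after division by [e / r] the left-hand side starts
    with [8 p], the right-hand side with [(73 / 20) * 2 p], that is [7.3 p]. The value [73 / 20]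
    bounds [1 + E * l / 16] when [E <= 6.41], [p < 3.2] and [r <= 1.02]. *)
Lemma energy_gap (p E e : R) (r := 1 + e) (l := 2 * p * r) :
  2 <= p -> p < 16 / 5 -> 0 < e -> e <= 1 / 50 ->
  l / r ^+ 2 <= E ->
  r ^+ 2 * l - 4 * p ^+ 2 / l <= r ^+ 4 * (E - l / r ^+ 2) * (1 + E * l / 16) ->
  2 * p + e / 20 <= E.
Proof.
move=> p2 p3 e0 e1; have p0 : 0 < p by lra.
have r_gt0 : 0 < r by rewrite /r; lra.
have r0 : r != 0 by rewrite gt_eqF.
have p_neq0 : p != 0 :> R by rewrite gt_eqF.
have -> : l / r ^+ 2 = 2 * p / r by rewrite /l; field.
have -> : 4 * p ^+ 2 / l = 2 * p / r by rewrite /l; field; rewrite r0 p_neq0.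
set q := 2 * p / r => E_ge h; rewrite leNgt; apply/negP => E_lt; move: h.
have q0 : 0 <= q by rewrite divr_ge0 ?(ltW r_gt0)// mulr_ge0// ltW.
have E0 : 0 <= E := le_trans q0 E_ge.
have l0 : 0 <= l by rewrite /l !mulr_ge0// ltW.
have eps_le : E - q <= e / r * (2 * p + r / 20).
  have -> : e / r * (2 * p + r / 20) = 2 * p + e / 20 - q by rewrite /q /r; field.
  by rewrite lerD2r ltW.
have factor_le : 1 + E * l / 16 <= 73 / 20.
  have El : E * p <= (32 / 5 + 1 / 100) * (16 / 5) by apply: ler_pM; lra.
  have : E * p * r <= (32 / 5 + 1 / 100) * (16 / 5) * (51 / 50).
    apply: ler_pM => //; [by rewrite mulr_ge0// ltW|exact: ltW|].
    by rewrite /r; lra.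
  have -> : E * l = 2 * (E * p * r) by rewrite /l; ring.
  move: (E * p * r) => z; clear; lra.
have rhs_le : (E - q) * (1 + E * l / 16) <= e / r * (2 * p + r / 20) * (73 / 20).
  apply: ler_pM => //; first by rewrite subr_ge0.
  by rewrite addr_ge0// divr_ge0// mulr_ge0.
rewrite -mulrA => /le_trans -/(_ _ (ler_wpM2l (exprn_ge0 4 (ltW r_gt0)) rhs_le)).
apply/negP; rewrite -ltNge -subr_gt0.
(* The factor [e / r] comes out of the left-hand side through [r ^+ 4 - 1 = e * (2 + e) * (2 + 2 * e
   + e ^+ 2)]. *)
have -> : r ^+ 2 * l - q - r ^+ 4 * (e / r * (2 * p + r / 20) * (73 / 20)) =
    e / r * (2 * p * (2 + e) * (2 + 2 * e + e ^+ 2) - r ^+ 4 * (2 * p + r / 20) * (73 / 20)).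
  by rewrite /q /l /r; field.
apply: mulr_gt0; first exact: divr_gt0.
have r4 : r ^+ 4 <= 1 + 5 * e.
  have -> : r ^+ 4 = 1 + 4 * e + e * (e * (6 + 4 * e + e ^+ 2)) by rewrite /r; ring.
  have : e * (e * (6 + 4 * e + e ^+ 2)) <= e * 1; last lra.
  rewrite ler_wpM2l ?(ltW e0)//.
  have : e ^+ 2 <= 1 by rewrite expr_le1 ?ltW//; lra.
  move=> e2; apply: (@le_trans _ _ (1 / 50 * 8)); last lra.
  by apply: ler_pM; [exact: ltW|rewrite !addr_ge0 ?mulr_ge0 ?sqr_ge0 ?ltW|lra|lra].
have big : 2 * p * 4 + 2 * p * (6 * e) <= 2 * p * (2 + e) * (2 + 2 * e + e ^+ 2).
  rewrite -mulrDr -[leRHS]mulrA; apply: ler_wpM2l; first by rewrite mulr_ge0// ltW.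
  have : 0 <= e ^+ 2 * (4 + e) by rewrite mulr_ge0 ?sqr_ge0//; lra.
  lra.
have small : r ^+ 4 * (2 * p + r / 20) * (73 / 20) <= (1 + 5 * e) * (2 * p + 51 / 1000) * (73 / 20).
  rewrite ler_wpM2r//; apply: ler_pM => //; [by rewrite exprn_ge0// ltW| |].
  - by rewrite addr_ge0 ?mulr_ge0 ?divr_ge0 ?ltW.
  - by rewrite /r; clear -e1; lra.
rewrite subr_gt0; apply: (le_lt_trans small); apply: lt_le_trans big.
(* Terms of order [p * e] cost at most [24.5 p e <= 0.49 p] of the available [0.7 p]; as [2 <= p],
   the rest covers the slack from [51 / 1000]. *)
have : p * e <= p * (1 / 50) by rewrite ler_wpM2l// ltW.
clear -p2 e0 e1; lra.
Qed.

End Numerics.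

(** * Ovals *)

Section Lfun_circle.
Context {R : realType}.
Implicit Types (f g : R -> R).
Notation mu := (@lebesgue_measure R).

Lemma integ_L1_circle f : integ 0 (2 * pi) f -> L1_circle f.
Proof. by move=> fi; apply/Lfun1_integrable; exact: integ_patch. Qed.

Lemma wcont_L2_circle f : wcont 0 (2 * pi) f -> L2_circle f.
Proof.
move=> cf; have fi := integ_patch (integ_cont cf).
have f2i := integ_patch (integ_cont (wcontX (n := 2) cf)).
rewrite /L2_circle inE; apply/andP; split; rewrite inE/=.
  by move/integrableP : fi => [/measurable_EFinP].
have /integrableP[_ foo] := f2i.
rewrite /finite_norm unlock; apply: poweR_lty.
apply: le_lt_trans foo; rewrite le_eqVlt; apply/orP; left; apply/eqP.
apply: eq_integral => x _ /=; rewrite powR_mulrn ?normr_ge0// !patchE.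
by case: ifP => _; rewrite ?expr0n/= ?normr0 ?normrX// expr0n.
Qed.

Lemma ac_weak_derivative f g : ac 0 (2 * pi) f g -> f (2 * pi) = f 0 -> weak_derivative f g.
Proof.
move=> fA f2; split.
- exact/integ_L1_circle/integ_cont/(AC_wcont fA).
- exact/integ_L1_circle/(AC_integ fA).
- by move=> phi tp; exact: ac_test.
Qed.

End Lfun_circle.

(* The curve with support function [p t = r + b cos (2 t)], i.e.
   [p (cos, sin) + p' (- sin, cos)]; its velocity is [(p + p'') (- sin, cos)]. *)
Definition oval (R : realType) (r b : R) (t : R) : R * R :=
  ((r + 3 * b) * cos t - 2 * b * cos t ^+ 3, (r - 3 * b) * sin t + 2 * b * sin t ^+ 3).

Definition oval_speed (R : realType) (r b : R) (t : R) : R := r + 3 * b - 6 * b * cos t ^+ 2.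

Section Oval.
Context {R : realType}.
Variables (r b : R).
Hypotheses (b0 : 0 <= b) (br : 3 * b < r).
Implicit Types t x : R.
Notation v := (oval_speed r b).
Notation mu := (@lebesgue_measure R).

Lemma oval_speed_gt0 t : 0 < v t.
Proof.
have : b * cos t ^+ 2 <= b * 1.
  by rewrite ler_wpM2l//; have := sin2cos2 t; have := sqr_ge0 (sin t); lra.
move=> h; have := br; rewrite /oval_speed; nra.
Qed.

Lemma is_derive_oval1 t : is_derive t 1 (fst \o oval r b) (- v t * sin t).
Proof.
have -> : fst \o oval r b = fun t => (r + 3 * b) * cos t - 2 * b * cos t ^+ 3 by [].
apply: is_derive_eq; rewrite /GRing.scale/= /oval_speed; ring.
Qed.

Lemma is_derive_oval2 t : is_derive t 1 (snd \o oval r b) (v t * cos t).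
Proof.
have -> : snd \o oval r b = fun t => (r - 3 * b) * sin t + 2 * b * sin t ^+ 3 by [].
apply: is_derive_eq; rewrite /GRing.scale/= /oval_speed.
transitivity ((r - 3 * b + 6 * b * (sin t ^+ 2)) * cos t); first by ring.
by rewrite sin2cos2; ring.
Qed.

Lemma is_derive_oval_velocity1 t :
  is_derive t 1 (fun t => - v t * sin t) (- (12 * b * cos t * sin t) * sin t - v t * cos t).
Proof.
rewrite /oval_speed; apply: is_derive_eq; rewrite /GRing.scale/=; ring.
Qed.

Lemma is_derive_oval_velocity2 t :
  is_derive t 1 (fun t => v t * cos t) (12 * b * cos t * sin t * cos t - v t * sin t).
Proof.
rewrite /oval_speed; apply: is_derive_eq; rewrite /GRing.scale/=; ring.
Qed.

Lemma velocity_oval t : velocity (oval r b) t = (- v t * sin t, v t * cos t).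
Proof.
by rewrite /velocity (is_derive_derive1 (is_derive_oval1 t)) (is_derive_derive1 (is_derive_oval2 t)).
Qed.

Lemma speed_oval t : speed (oval r b) t = v t.
Proof.
rewrite /speed /enorm velocity_oval /dot/=.
have -> : - v t * sin t * (- v t * sin t) + v t * cos t * (v t * cos t) = v t ^+ 2.
  by rewrite -[RHS]mulr1 -(cos2Dsin2 t); ring.
by rewrite sqrtr_sqr gtr0_norm// oval_speed_gt0.
Qed.

Lemma tangent_oval t : tangent (oval r b) t = (- sin t, cos t).
Proof.
rewrite /tangent velocity_oval speed_oval /=; have := oval_speed_gt0 t => /gt_eqF/negbT v0.
by congr (_, _); field.
Qed.

Lemma normal_oval t : normal (oval r b) t = (- cos t, - sin t).
Proof. by rewrite /normal tangent_oval. Qed.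

Lemma cos_2pi_add t : cos (t + 2 * pi) = cos t.
Proof. by rewrite mulr_natl cosD2pi. Qed.

Lemma sin_2pi_add t : sin (t + 2 * pi) = sin t.
Proof. by rewrite mulr_natl sinD2pi. Qed.

Lemma continuous_oval_speed : continuous v.
Proof.
apply: derivable_continuous => t.
by have : is_derive t 1 v (12 * b * cos t * sin t);
  [rewrite /oval_speed; apply: is_derive_eq; rewrite /GRing.scale/=; ring|case].
Qed.

Let cvT := continuous_oval_speed.

Lemma W22_oval : W22 (fst \o oval r b) /\ W22 (snd \o oval r b).
Proof.
have p0 := ltW (@twopi_gt0 R).
have c2 : (cos (2 * pi) = cos 0 :> R) by rewrite -{1}[2 * pi]add0r cos_2pi_add.
have s2 : (sin (2 * pi) = sin 0 :> R) by rewrite -{1}[2 * pi]add0r sin_2pi_add.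
have csin x y : wcont x y (@sin R) by apply: wcontT; exact: continuous_sin.
have ccos x y : wcont x y (@cos R) by apply: wcontT; exact: continuous_cos.
have cv x y : wcont x y v by exact: wcontT.
have w22 (f f1 f2 : R -> R) : (forall t, is_derive t 1 f (f1 t)) ->
    (forall t, is_derive t 1 f1 (f2 t)) -> wcont 0 (2 * pi) f2 ->
    periodic f (2 * pi) -> f1 (2 * pi) = f1 0 -> W22 f.
  move=> df df1 cf2 pf pf1.
  have cf : continuous f by apply: derivable_continuous => t; have [] := df t.
  have cf1 : continuous f1 by apply: derivable_continuous => t; have [] := df1 t.
  split=> //; exists f1, f2; split.
  - exact/wcont_L2_circle/wcontT.
  - exact/wcont_L2_circle/wcontT.
  - exact: wcont_L2_circle.
  - apply: ac_weak_derivative; first exact: AC_C1.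
    by rewrite -[2 * pi]add0r pf.
  - apply: ac_weak_derivative => //; apply: AC_smooth => //; exact: wcontT.
have cdv : wcont 0 (2 * pi) (fun t => 12 * b * cos t * sin t).
  by apply: wcontM => //; apply: wcontM => //; exact: wcont_cst.
split.
- apply: (w22 _ _ _ is_derive_oval1 is_derive_oval_velocity1).
  + exact: (wcontB (wcontM (wcontN cdv) (csin _ _)) (wcontM (cv _ _) (ccos _ _))).
  + by move=> t; rewrite /= cos_2pi_add.
  + by rewrite /oval_speed c2 s2.
- apply: (w22 _ _ _ is_derive_oval2 is_derive_oval_velocity2).
  + exact: (wcontB (wcontM cdv (ccos _ _)) (wcontM (cv _ _) (csin _ _))).
  + by move=> t; rewrite /= sin_2pi_add.
  + by rewrite /oval_speed c2.
Qed.

Lemma W22_Imm_oval : W22_Imm (oval r b).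
Proof.
have [h1 h2] := W22_oval; split => // t.
apply/negP => /eqP vel0; have := speed_oval t.
rewrite /speed /enorm vel0 /dot/= mul0r addr0 sqrtr0 => v0.
by have := oval_speed_gt0 t; rewrite -v0 ltxx.
Qed.

Let sinA : ac 0 (2 * pi) (fun t : R => (tangent (oval r b) t).1) (fun t => - cos t).
Proof.
have p0 := ltW (@twopi_gt0 R).
apply: (eq_AC (F := fun t => - sin t) (f := fun t => - cos t)) => //.
  by move=> t _; rewrite tangent_oval.
apply: ACN; apply: AC_C1 => //; exact: continuous_cos.
Qed.

Let cosA : ac 0 (2 * pi) (fun t : R => (tangent (oval r b) t).2) (fun t => - sin t).
Proof.
have p0 := ltW (@twopi_gt0 R).
apply: (eq_AC (F := fun t => cos t) (f := fun t => - sin t)) => //.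
  by move=> t _; rewrite tangent_oval.
apply: AC_C1 => // t; apply: continuousN; exact: continuous_sin.
Qed.

(** The witness [1 / v] only keeps [xget] from its default value; the representative it picks may
    differ from [1 / v] on a null set. *)
Lemma is_curvature_oval : is_curvature (oval r b) (curvature (oval r b)).
Proof.
rewrite /curvature; case: xgetP => [k _ //|hno].
suff h : is_curvature (oval r b) (fun t => (v t)^-1) by case: (hno _ h).
have c2 : (cos (2 * pi) = cos 0 :> R) by rewrite -{1}[2 * pi]add0r cos_2pi_add.
have s2 : (sin (2 * pi) = sin 0 :> R) by rewrite -{1}[2 * pi]add0r sin_2pi_add.
have v_neq0 t : v t != 0 by rewrite gt_eqF// oval_speed_gt0.
split.
- apply: (wcont_measurable (a := 0) (b := 2 * pi)).
  by apply: wcontV => // ; exact: wcontT.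
- apply: ac_weak_derivative; last by rewrite !tangent_oval /= s2.
  apply: eq_AC sinA => // t _; rewrite normal_oval speed_oval /=.
  by field.
- apply: ac_weak_derivative; last by rewrite !tangent_oval /= c2.
  apply: eq_AC cosA => // t _; rewrite normal_oval speed_oval /=.
  by field.
Qed.

(** The chosen curvature and the explicit derivative are two densities of the same tangent, so their
    difference has vanishing primitive. *)
Lemma curvature_oval : {ae mu, forall t, 0 <= t <= 2 * pi -> curvature (oval r b) t * v t = 1}.
Proof.
have p0 := ltW (@twopi_gt0 R).
have [_ w1 w2] := is_curvature_oval.
have A1 := weak_derivative_ac (AC_wcont sinA) w1.
have A2 := weak_derivative_ac (AC_wcont cosA) w2.
have ae (F f g : R -> R) : ac 0 (2 * pi) F f -> ac 0 (2 * pi) F g ->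
    {ae mu, forall t, 0 <= t <= 2 * pi -> f t - g t = 0}.
  move=> Ff Fg; apply: itg_eq0_ae => //.
    by apply: integB; [exact: AC_integ Ff|exact: AC_integ Fg].
  move=> t /andP[t0 t2]; have := AC_itg Ff (lexx 0) t0 t2.
  rewrite (AC_itg Fg (lexx 0) t0 t2) => /addrI e.
  rewrite itgB ?e ?subrr//.
    exact: integS (AC_integ Ff).
  exact: integS (AC_integ Fg).
have aeF := ae_filter_ringOfSetsType mu.
have := @filterI _ _ aeF _ _ (ae _ _ _ A1 sinA) (ae _ _ _ A2 cosA).
apply: (@filterS _ _ aeF) => t [h1 h2] tp.
have := h1 tp; have := h2 tp; rewrite normal_oval speed_oval /=.
set k := curvature _ t => e2 e1.
(* Either component alone says nothing where its trigonometric factor vanishes; their combination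
   does everywhere. *)
have : (k * v t - 1) * (cos t ^+ 2 + sin t ^+ 2) = 0.
  transitivity (- cos t * (v t * (k * - cos t) - - cos t)
                - sin t * (v t * (k * - sin t) - - sin t)); first by ring.
  by rewrite e1 e2; ring.
by rewrite cos2Dsin2 mulr1 => /eqP; rewrite subr_eq0 => /eqP.
Qed.

Let measurable_curvature : measurable_fun `[0, 2 * pi] (curvature (oval r b)).
Proof. by have [mk _ _] := is_curvature_oval. Qed.

Let measurable_v : measurable_fun `[0, 2 * pi] v.
Proof. by apply: wcont_measurable; exact: wcontT. Qed.

Lemma winding_oval : winding (oval r b) = 1.
Proof.
rewrite /winding /int_ds circle_int_itg (itg_ae (g := fun=> 1)).
- by rewrite itg_cst ?subr0 ?mul1r ?mulVf// ?gt_eqF ?ltW ?twopi_gt0.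
- apply: measurable_funM => //.
  by rewrite (_ : speed _ = v)//; apply/funext => t; exact: speed_oval.
- exact: measurable_cst.
have aeF := ae_filter_ringOfSetsType mu.
have := curvature_oval; apply: (@filterS _ _ aeF) => t h tp.
by rewrite speed_oval h.
Qed.

Lemma itg_of_derive (F f : R -> R) : continuous f -> (forall t, is_derive t 1 F (f t)) ->
  itg 0 (2 * pi) f = F (2 * pi) - F 0.
Proof.
move=> cf Ff; have p0 := ltW (@twopi_gt0 R).
by rewrite (AC_itg (AC_C1 p0 cf Ff) (lexx _) p0 (lexx _)) addrC addKr.
Qed.

Let sin2pi0 : sin (2 * pi) = 0 :> R.
Proof. by rewrite -[2 * pi]add0r sin_2pi_add sin0. Qed.

Lemma curve_length_oval : curve_length (oval r b) = 2 * pi * r.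
Proof.
rewrite /curve_length /int_ds circle_int_itg.
rewrite (eq_itg (g := v)) => [|t _]; last by rewrite mul1r speed_oval.
have dF t : is_derive t 1 (fun t => r * t - 3 * b * (sin t * cos t)) (v t).
  apply: is_derive_eq; rewrite /GRing.scale/= /oval_speed.
  transitivity (r - 3 * b * cos t ^+ 2 + 3 * b * sin t ^+ 2); first by ring.
  by rewrite sin2cos2; ring.
by rewrite (itg_of_derive cvT dF) sin2pi0 sin0; ring.
Qed.

(* With [D = cos (2 t) = cos ^+ 2 - sin ^+ 2] the integrand is
   [- (r + b D) (r - 3 b D)]. *)
Lemma area_oval : area (oval r b) = pi * (r ^+ 2 - 3 / 2 * b ^+ 2).
Proof.
rewrite /area /int_ds circle_int_itg.
pose D (t : R) := 2 * cos t ^+ 2 - 1.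
rewrite (eq_itg (g := fun t => - ((r + b * D t) * (r - 3 * b * D t)))) => [|t _]; last first.
  rewrite normal_oval speed_oval /dot /oval /oval_speed /D /=.
  transitivity (- (((r + 3 * b) * cos t ^+ 2 - 2 * b * (cos t ^+ 2) ^+ 2
    + (r - 3 * b) * sin t ^+ 2 + 2 * b * (sin t ^+ 2) ^+ 2) *
    (r + 3 * b - 6 * b * cos t ^+ 2))); first by ring.
  by rewrite sin2cos2; ring.
pose f t := - ((r + b * D t) * (r - 3 * b * D t)).
have df t : is_derive t 1 f (- (b * - (4 * cos t * sin t) * (r - 3 * b * D t)
    + (r + b * D t) * (3 * b * (4 * cos t * sin t)))).
  by rewrite /f /D; apply: is_derive_eq; rewrite /GRing.scale/=; ring.
have cf : continuous f by apply: derivable_continuous => t; have [] := df t.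
have dF t : is_derive t 1 (fun t => - (r ^+ 2 * t - 2 * r * b * (sin t * cos t)
    - 3 * b ^+ 2 * (t / 2 + sin t * cos t * D t / 2))) (f t).
  rewrite /f /D; apply: is_derive_eq; rewrite /GRing.scale/=.
  transitivity (- (r ^+ 2 - 2 * r * b * (cos t ^+ 2 - sin t ^+ 2) - 3 / 2 * b ^+ 2 *
    (1 + (cos t ^+ 2 - sin t ^+ 2) * (2 * cos t ^+ 2 - 1) - 4 * sin t ^+ 2 * cos t ^+ 2))).
    by field.
  by rewrite sin2cos2; field.
by rewrite (itg_of_derive cf dF) sin2pi0 sin0; field.
Qed.

Lemma oval_admissible : r ^+ 2 - 3 / 2 * b ^+ 2 = 1 -> admissible (2 * pi * r) (oval r b).
Proof.
move=> rb; split.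
- exact: W22_Imm_oval.
- exact: winding_oval.
- by rewrite area_oval rb mulr1.
- exact: curve_length_oval.
Qed.

End Oval.

(** * The energy gap *)

Section LowerBound.
Context {R : realType}.
Implicit Types (gam : R -> R * R) (x c : R).

Lemma enorm_gt0 (u : R * R) : u != 0 -> 0 < enorm u.
Proof.
move=> u0; rewrite /enorm sqrtr_gt0 /dot -!expr2.
rewrite lt_neqAle addr_ge0 ?sqr_ge0// andbT eq_sym paddr_eq0 ?sqr_ge0//.
rewrite !sqrf_eq0; apply: contra u0 => /andP[/eqP e1 /eqP e2].
by rewrite [u]surjective_pairing e1 e2.
Qed.

(* Without curvature the default value [0] would give winding number [0]. *)
Lemma winding_is_curvature gam : winding gam = 1 -> is_curvature gam (curvature gam).
Proof.
rewrite /winding /curvature; case: xgetP => [k _ //|_].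
rewrite /int_ds circle_int_itg (eq_itg (g := fun=> 0)) => [|x _]; last by rewrite mul0r.
rewrite itg_cst ?ltW ?twopi_gt0// mul0r mulr0 => /esym/eqP.
by rewrite oner_eq0.
Qed.

(** The translation required by Wirtinger subtracts the two constants [c1] and [c2], one per
    coordinate; tangent, curvature and speed do not see it, and the area is unchanged because the
    curve closes up. *)
Lemma admissible_energy gam (l : R) (r := l / (2 * pi)) : admissible l gam ->
  l / r ^+ 2 <= energy gam /\
  r ^+ 2 * l - 4 * pi ^+ 2 / l <=
    r ^+ 4 * (energy gam - l / r ^+ 2) * (1 + energy gam * l / 16).
Proof.
move=> [[W1 W2 imm] wind ar len].
have [mk w1 w2] := winding_is_curvature wind.
set k := curvature gam in mk w1 w2 *.
have p0 := @twopi_gt0 R.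
have [a1 [a1i x1A d1A d1p]] := W22_ac W1.
have [a2 [a2i x2A d2A d2p]] := W22_ac W2.
set x1 := fst \o gam in x1A d1A d1p W1 *; set x2 := snd \o gam in x2A d2A d2p W2 *.
pose v := speed gam.
have v0 x : 0 < v x by apply: enorm_gt0; exact: imm.
have cd1 := AC_wcont d1A; have cd2 := AC_wcont d2A.
have cv : wcont 0 (2 * pi) v.
  apply: (wcont_comp (f := fun x => derive1 x1 x * derive1 x1 x + derive1 x2 x * derive1 x2 x)
    (g := Num.sqrt)); last exact: sqrt_continuous.
  by apply: wcontD; exact: wcontM.
pose t1 x := (tangent gam x).1; pose t2 x := (tangent gam x).2.
have d1E x : derive1 x1 x = v x * t1 x by rewrite /t1 /tangent /= mulrC divfK// gt_eqF// v0.
have d2E x : derive1 x2 x = v x * t2 x by rewrite /t2 /tangent /= mulrC divfK// gt_eqF// v0.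
have t12 x : t1 x ^+ 2 + t2 x ^+ 2 = 1.
  have v2 : derive1 x1 x ^+ 2 + derive1 x2 x ^+ 2 = v x ^+ 2.
    by rewrite /v /speed /enorm sqr_sqrtr /dot /= -!expr2// addr_ge0 ?sqr_ge0.
  have vx : v x ^+ 2 != 0 by rewrite expf_neq0// gt_eqF.
  by apply: (mulfI vx); rewrite mulr1 -[RHS]v2 d1E d2E; ring.
have cv' : wcont 0 (2 * pi) (fun x => (v x)^-1) by apply: wcontV => // x _; rewrite gt_eqF.
have ct1 : wcont 0 (2 * pi) t1 by exact: wcontM.
have ct2 : wcont 0 (2 * pi) t2 by exact: wcontM.
have t1A := weak_derivative_ac ct1 w1; have t2A := weak_derivative_ac ct2 w2.
have vel_p : velocity gam (2 * pi) = velocity gam 0.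
  by rewrite /velocity d1p d2p.
have v_p : v (2 * pi) = v 0 by rewrite /v /speed vel_p.
have t1p : t1 (2 * pi) = t1 0 by rewrite /t1 /tangent vel_p -/(v _) v_p.
have t2p : t2 (2 * pi) = t2 0 by rewrite /t2 /tangent vel_p -/(v _) v_p.
have x1p : x1 (2 * pi) = x1 0 by have [px _ _] := W1; rewrite -[2 * pi]add0r px.
have x2p : x2 (2 * pi) = x2 0 by have [px _ _] := W2; rewrite -[2 * pi]add0r px.
(* This guards the meaning of [energy]: the real-valued integral would read an infinite value as
   [0]. *)
have Ei : integ 0 (2 * pi) (fun x => k x ^+ 2 * v x).
  by apply: (curvature_sq_integ (ltW p0) d1A d2A t1A t2A a1i a2i cv).
have lE : l = itg 0 (2 * pi) v.
  by rewrite -len /curve_length /int_ds circle_int_itg; apply: eq_itg => x _; rewrite mul1r.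
have [c1 hc1] := weighted_wirtinger p0 x1A cd1 cv (fun x _ => v0 x) x1p.
have [c2 hc2] := weighted_wirtinger p0 x2A cd2 cv (fun x _ => v0 x) x2p.
have y1A : ac 0 (2 * pi) (fun x => x1 x - c1) (derive1 x1).
  apply: eq_AC (ACB x1A (AC_cst _ _ c1)) => x _; [by []|exact: subr0].
have y2A : ac 0 (2 * pi) (fun x => x2 x - c2) (derive1 x2).
  apply: eq_AC (ACB x2A (AC_cst _ _ c2)) => x _; [by []|exact: subr0].
have vt1 : itg 0 (2 * pi) (fun x => v x * t1 x) = 0.
  have := AC_itg x1A (lexx 0) (ltW p0) (lexx _).
  rewrite x1p -[X in X = _ -> _]addr0 => /addrI e0.
  by rewrite [RHS]e0; apply: eq_itg => x _; rewrite d1E.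
have vt2 : itg 0 (2 * pi) (fun x => v x * t2 x) = 0.
  have := AC_itg x2A (lexx 0) (ltW p0) (lexx _).
  rewrite x2p -[X in X = _ -> _]addr0 => /addrI e0.
  by rewrite [RHS]e0; apply: eq_itg => x _; rewrite d2E.
have cx1 := AC_wcont x1A; have cx2 := AC_wcont x2A.
have areaE : pi = - 2^-1 * itg 0 (2 * pi)
    (fun x => (t1 x * (x2 x - c2) - t2 x * (x1 x - c1)) * v x).
  rewrite -[LHS]ar /area /int_ds circle_int_itg; congr (_ * _).
  rewrite [RHS](eq_itg (g := fun x => dot (normal gam x) (gam x) * v x +
      (c1 * (v x * t2 x) - c2 * (v x * t1 x)))); last first.
    by move=> x _; rewrite /dot /normal /= /t1 /t2 /x1 /x2 /=; ring.
  have i1 : integ 0 (2 * pi) (fun x => v x * t1 x) by apply: integ_cont; exact: wcontM.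
  have i2 : integ 0 (2 * pi) (fun x => v x * t2 x) by apply: integ_cont; exact: wcontM.
  rewrite itgD; [|apply: integ_cont; apply: wcontM; [|exact: cv]|by apply: integB; exact: integZ].
    rewrite itgB; [|exact: integZ|exact: integZ].
    by rewrite (itgZ _ i1) (itgZ _ i2) vt1 vt2 !mulr0 subr0 addr0.
  apply: wcontD; apply: wcontM; [|exact: cx1|exact: ct1|exact: cx2].
  exact: wcontN ct2.
have := @frame_inequality R _ _ _ _ t1 t2 _ _ v k _ p0 y1A y2A t1A t2A.
rewrite x1p x2p => /(_ erefl erefl t1p t2p cv (fun x _ => v0 x)).
move=> /(_ (fun x _ => d1E x) (fun x _ => d2E x) (fun x _ => t12 x)).
move=> /(_ (fun x _ => erefl) (fun x _ => erefl) Ei).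
rewrite /= -lE -areaE -/r; apply.
have iy (x c : R) (f : R -> R) : wcont 0 (2 * pi) f ->
    integ 0 (2 * pi) (fun x => (f x - c) ^+ 2 * v x).
  move=> cf; apply: integ_cont; apply: wcontM; [apply: wcontX|exact: cv].
  by apply: wcontB; [exact: cf|exact: wcont_cst].
have id (f : R -> R) : wcont 0 (2 * pi) f -> integ 0 (2 * pi) (fun x => f x ^+ 2 / v x).
  by move=> cf; apply: integ_cont; apply: wcontM; [exact: wcontX|exact: cv'].
rewrite (eq_itg (g := fun x => (x1 x - c1) ^+ 2 * v x + (x2 x - c2) ^+ 2 * v x)); last first.
  by move=> x _; ring.
rewrite itgD; [|exact: iy|exact: iy].
apply: (le_trans (lerD hc1 hc2)); rewrite -mulrDr -lE -/r -itgD; [|exact: id|exact: id].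
(* The two Dirichlet integrals add up to the length, since the tangent is a unit vector. *)
rewrite le_eqVlt; apply/orP; left; apply/eqP; congr (_ * _); rewrite lE.
apply: eq_itg => x _.
rewrite d1E d2E; transitivity ((t1 x ^+ 2 + t2 x ^+ 2) * v x); last by rewrite t12 mul1r.
by field; rewrite gt_eqF.
Qed.

Lemma energy_ge0 gam : 0 <= energy gam.
Proof.
apply: itg_ge0 => x _; apply: mulr_ge0; first exact: sqr_ge0.
exact: sqrtr_ge0.
Qed.

Lemma energy_profile_le_circle : energy_profile (2 * pi : R) <= 2 * pi.
Proof.
have br : 3 * 0 < 1 :> R by rewrite mulr0.
have circ : admissible (2 * pi : R) (oval 1 0).
  have := oval_admissible (lexx 0) br; rewrite mulr1; apply.
  by rewrite expr1n expr0n/= mulr0 subr0.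
have E1 : energy (oval 1 0 : R -> R * R) = 2 * pi.
  have v1 (x : R) : oval_speed 1 0 x = 1 by rewrite /oval_speed; ring.
  have [mk _ _] := is_curvature_oval (lexx 0) br.
  rewrite /energy /int_ds circle_int_itg (itg_ae (g := fun=> 1)).
  - by rewrite itg_cst ?subr0 ?mul1r// ltW// twopi_gt0.
  - apply: measurable_funM; first exact: measurable_funX.
    rewrite (_ : speed _ = fun=> 1); first exact: measurable_cst.
    by apply/funext => x; rewrite (speed_oval (lexx 0) br) v1.
  - exact: measurable_cst.
  have aeF := ae_filter_ringOfSetsType (@lebesgue_measure R).
  have := curvature_oval (lexx 0) br; apply: (@filterS _ _ aeF) => x h xp.
  have := h xp; rewrite (speed_oval (lexx 0) br) v1 !mulr1 => ->.
  by rewrite expr1n.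
rewrite -[leRHS]E1; apply: ge_inf.
  by exists 0 => _ [gam _ <-]; exact: energy_ge0.
by exists (oval 1 0).
Qed.

Lemma energy_profile_gt : exists2 l : R, 2 * pi <= l & 2 * pi < energy_profile l.
Proof.
pose e : R := 1 / 50; pose r := 1 + e.
have e0 : 0 < e by rewrite /e; lra.
have r1 : 1 < r by rewrite /r; lra.
have r2 : r ^+ 2 <= 11 / 10 by rewrite /r /e; lra.
(* This solves the area condition [r ^+ 2 - 3 / 2 * b ^+ 2 = 1]. Positivity of the speed,
   [3 * b < r], then amounts to [r ^+ 2 < 6 / 5]. *)
pose b := Num.sqrt (2 / 3 * (r ^+ 2 - 1)).
have rr : 1 < r ^+ 2 by rewrite exprn_egt1.
have b2 : b ^+ 2 = 2 / 3 * (r ^+ 2 - 1) by rewrite sqr_sqrtr// mulr_ge0// subr_ge0 ltW.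
have b0 : 0 <= b by exact: sqrtr_ge0.
have br : 3 * b < r.
  rewrite -ltr_sqr ?nnegrE ?mulr_ge0//; last by apply: le_trans (ltW r1).
  by rewrite exprMn b2; lra.
have pi0 := @pi_gt0 R.
exists (2 * pi * r); first by rewrite ler_peMr ?mulr_ge0 ?ltW.
apply: (@lt_le_trans _ _ (2 * pi + e / 20)); first by rewrite ltrDl divr_gt0.
(* Nonemptiness is essential: the infimum of the empty set is [0] by convention, which would defeat
   the lower bound. *)
apply: lb_le_inf.
  exists (energy (oval r b)), (oval r b) => //; apply: oval_admissible => //.
  by rewrite b2; field.
move=> _ [gam /admissible_energy + <-].
have -> : 2 * pi * r / (2 * pi) = r by rewrite mulrC mulKf// gt_eqF// mulr_gt0.
move=> [h1 h2]; apply: energy_gap h1 h2 => //.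
- exact: pi_ge2.
- exact: pi_lt_16_5.
Qed.

End LowerBound.

Unset Implicit Arguments.

Theorem theorem5p9 (R : realType) (lstar : R)
    (lstar_ge : 2 * pi <= lstar)
    (lstar_max : forall l : R, 2 * pi <= l ->
       energy_profile l <= energy_profile lstar) :
  2 * pi < energy_profile lstar /\ lstar <> 2 * pi.
Proof.
have [l l2 El] := @energy_profile_gt R.
have gap : 2 * pi < energy_profile lstar by exact: lt_le_trans El (lstar_max l l2).
split => // lE; move: gap; rewrite lE ltNge.
by rewrite energy_profile_le_circle.
Qed.
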